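(* Consider the following assertion $(\ast)$ about a matroid $M$ of rank $r\ge 3$: $$(\ast)\qquad (1+T)^{r-1} < \frac{\mathcal{N}_M(1,T)}{\pi_M(1)} < E_r^{\mathsf{B}}(T).$$ (1) If $(\ast)$ holds for all matroids $M$ of rank $r\geq 3$, then the bounds in $(\ast)$ are sharp; that is, for every $r\ge 3$ there are matroids $M$ of rank $r$ for which $\mathcal{N}_M(1,T)/\pi_M(1)$ is arbitrarily close to $(1+T)^{r-1}$, and matroids $M$ of rank $r$ for which it is arbitrarily close to $E_r^{\mathsf{B}}(T)$. (2) Assertion $(\ast)$ holds for all matroids of rank $3$. Moreover, for every orientable matroid $M$ of rank $r\geq 3$, the upper bound holds for the linear term: the coefficient of $T$ in $\mathcal{N}_M(1,T)/\pi_M(1)$ is strictly less than the coefficient of $T$ in $E_r^{\mathsf{B}}(T)$; and assertion $(\ast)$ holds for all orientable matroids of rank $4$.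
   Context: Matroids: a matroid $M=(E,\mathcal{L}(M))$ is given by a finite ground set $E$ and its lattice of flats $\mathcal{L}(M)$ (ordered by inclusion, with bottom $\hat 0$, top $\hat 1=E$, rank function $r(X)$, and $r(M)=r(E)$). For flats $X\subseteq X'$, the lattice of flats of the minor $M/X|X'$ is isomorphic to the interval $[X,X']$ of $\mathcal{L}(M)$. The Möbius function is defined by $\mu_M(\hat 0)=1$, $\mu_M(X)=-\sum_{X'<X}\mu_M(X')$. The Poincaré polynomial is $\pi_M(Y)=\sum_{X\in\mathcal{L}(M)}\mu_M(X)(-Y)^{r(X)}$. Put $\overline{\mathcal{L}}(M)=\mathcal{L}(M)\setminus\{\hat 0,\hat 1\}$, and let $\Delta(\overline{\mathcal{L}}(M))$ be the set of all flags (finite chains, including the empty one) in it. For a flag $F=(X_1<\cdots<X_\ell)$, $\ell\ge 0$, with $X_0=\hat 0$, $X_{\ell+1}=\hat 1$, set $|F|=\ell$ and $\pi_F(Y)=\prod_{k=0}^{\ell}\pi_{M/X_k|X_{k+1}}(Y)$. The coarse flag polynomial is $$\mathcal{N}_M(Y,T)=\sum_{F\in\Delta(\overline{\mathcal{L}}(M))}\pi_F(Y)\,T^{|F|}(1-T)^{r(M)-1-|F|}.$$ A matroid is orientable if it is the underlying matroid of some oriented matroid. For a finite simplicial complex $\Sigma$ of dimension $d-1$, let $f_k$ be the number of faces with $k$ vertices, $f(\Sigma;T)=\sum_{k=0}^d f_kT^k$, and $h(\Sigma;T)=(1-T)^d f(\Sigma;T/(1-T))$ (the $h$-polynomial). For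 $r\ge 1$, $E_r^{\mathsf{B}}(T)$ is the $h$-polynomial of the barycentric subdivision of the boundary of the $(r-1)$-dimensional cross-polytope (equivalently the descent polynomial of the Coxeter group of type $\mathsf{B}_{r-1}$); for example $E_3^{\mathsf{B}}(T)=1+6T+T^2$. For polynomials $f,g\in\mathbb{Q}[T]$, $f\le g$ means that each coefficient of $f$ is at most the corresponding coefficient of $g$; $f<g$ means $f\le g$ and $f\ne g$. Closeness of polynomials of degree at most $r-1$ is measured by the Euclidean distance of their coefficient vectors in $\mathbb{R}^{r}$. *)

(* Defs.v *)
From HB Require Import structures.
From mathcomp Require Import all_boot all_order all_algebra.
From mathcomp Require Import reals.

Set Implicit Arguments.
Unset Strict Implicit.
Unset Printing Implicit Defensive.

Import Order.TTheory GRing.Theory Num.Theory.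
Local Open Scope ring_scope.

Section Families.
Variable T : finType.
Implicit Types (A B E F G X : {set T}) (L P C : {set {set T}}).

Definition is_chain C : bool :=
  [forall A in C, forall B in C, (A \subset B) || (B \subset A)].

Definition order_complex P : {set {set {set T}}} :=
  [set C : {set {set T}} | (C \subset P) && is_chain C].

Definition covers L F G : Prop :=
  [/\ F \in L, G \in L, F \proper G &
      forall H : {set T}, H \in L -> F \proper H -> ~~ (H \proper G)].

(* Loops and parallel elements are allowed: bot L below may be nonempty. *)
Definition is_flats E L : Prop :=
  [/\ forall F, F \in L -> F \subset E,
      E \in L,
      forall F G, F \in L -> G \in L -> F :&: G \in L
    & forall F e, F \in L -> e \in E :\: F ->
        exists! G, covers L F G /\ e \in G].

Definition bot L : {set T} := \bigcap_(X in L) X.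

(* The largest length k of a chain X_0 < ... < X_k in L with X_k <= X. *)
Definition rk L X : nat :=
  (\max_(C in order_complex [set Z in L | Z \subset X]) #|C|).-1.

(* Recursion on the cardinality of X, with n as fuel; see mobius_bot and
   mobius_rec for the defining equations. *)
Fixpoint mobius_fuel n L X : int :=
  if n is n'.+1 then
    if X == bot L then 1
    else - \sum_(Z in L | Z \proper X) mobius_fuel n' L Z
  else 0.

Definition mobius L X : int := mobius_fuel #|X|.+1 L X.

Lemma mobius_fuelE n m L X :
  (#|X| < n)%N -> (#|X| < m)%N -> mobius_fuel n L X = mobius_fuel m L X.
Proof.
elim: n m X => // n IHn [|m] X //= Xn Xm.
case: eqP => // _; congr (- _); apply: eq_bigr => Z /andP[_ ZX].
by apply: IHn; apply: leq_trans (proper_card ZX) _.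
Qed.

Lemma mobius_bot L : mobius L (bot L) = 1.
Proof. by rewrite /mobius /= eqxx. Qed.

Lemma mobius_rec L X : X != bot L ->
  mobius L X = - \sum_(Z in L | Z \proper X) mobius L Z.
Proof.
move=> /negPf Xbot; rewrite {1}/mobius /= Xbot; congr (- _).
apply: eq_bigr => Z /andP[_ ZX]; apply: mobius_fuelE => //.
exact: proper_card.
Qed.

Definition poincare L : {poly rat} :=
  \sum_(X in L) (mobius L X)%:~R *: (- 'X) ^+ rk L X.

(* The flats of the minor M/X|X', on the ground set X' :\: X. *)
Definition minor_flats L X X' : {set {set T}} :=
  [set F :\: X | F in [set F in L | (X \subset F) && (F \subset X')]].

Lemma minor_flatsP E L X X' : is_flats E L -> X \in L -> X' \in L ->
  X \subset X' -> is_flats (X' :\: X) (minor_flats L X X').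
Proof.
move=> [LE EL LI Lcov] XL X'L XX'.
have inP F : reflect (exists2 G, [/\ G \in L, X \subset G & G \subset X'] &
    F = G :\: X) (F \in minor_flats L X X').
  apply: (iffP imsetP) => -[G].
    by rewrite inE => /and3P[? ? ?] ->; exists G.
  by move=> [? ? ?] ->; exists G => //; rewrite inE; apply/and3P.
have prD A B : X \subset A -> X \subset B ->
    (A :\: X \proper B :\: X) = (A \proper B).
  have sD A' B' : X \subset A' -> X \subset B' ->
      (A' :\: X \subset B' :\: X) = (A' \subset B').
    by move=> XA XB; rewrite subDset setDE setUIr setUCr setIT (setUidPr XB).
  by move=> XA XB; rewrite !properE !sD.
split.
- by move=> F /inP[G [_ _ GX'] ->]; apply: setSD.
- by apply/inP; exists X'.
- move=> F G /inP[A [AL XA AX'] ->] /inP[B [BL XB BX'] ->].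
  apply/inP; exists (A :&: B); last by rewrite -setDIl.
  by split; [exact: LI | rewrite subsetI XA | rewrite subIset ?AX'].
- move=> F e /inP[A [AL XA AX'] ->].
  rewrite !inE => /andP[eA /andP[eX eX']].
  have eNA : e \notin A by move: eA; rewrite eX.
  have eE : e \in E :\: A by rewrite inE eNA (subsetP (LE _ X'L)).
  have [G [[[_ GL AG Gcov] eG] Guniq]] := Lcov _ _ AL eE.
  have XG : X \subset G := subset_trans XA (proper_sub AG).
  have GX' : G \subset X'.
    have AGX : A \proper G :&: X'.
      apply/properP; split; first by rewrite subsetI proper_sub.
      by exists e => //; rewrite inE eG.
    have := Gcov _ (LI _ _ GL X'L) AGX.
    rewrite properE subsetIl /= negbK => /subset_trans; apply.
    exact: subsetIr.
  exists (G :\: X); split.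
    split; last by rewrite inE eX.
    split; [by apply/inP; exists A | by apply/inP; exists G | by rewrite prD |].
    by move=> H /inP[B [BL XB BX'] ->]; rewrite !prD //; exact: Gcov.
  move=> H [[_ /inP[B [BL XB BX'] ->] + Bcov] eB].
  rewrite prD // => AB; congr (_ :\: _); apply: Guniq; split; last first.
    by move: eB; rewrite inE => /andP[].
  split=> // K KL AK; apply/negP => KB.
  have XK : X \subset K := subset_trans XA (proper_sub AK).
  have KX : K :\: X \in minor_flats L X X'.
    apply/inP; exists K => //; split=> //.
    exact: subset_trans (proper_sub KB) BX'.
  by have := Bcov _ KX; rewrite !prD // KB AK => /(_ isT).
Qed.

End Families.

Record matroid (T : finType) := Matroid {
  ground : {set T};
  flats : {set {set T}};
  flatsP : is_flats ground flats
}.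

Section Matroid.
Variables (T : finType) (M : matroid T).
Implicit Types (A C I X : {set T}) (F : {set {set T}}).

Definition rank : nat := rk (flats M) (ground M).

Definition proper_flats : {set {set T}} :=
  flats M :\: [set bot (flats M); ground M].

(* The sequence X_0 < X_1 < ... < X_l < X_(l+1) attached to a flag F. *)
Definition flag_seq F : seq {set T} :=
  bot (flats M) ::
    rcons (sort (fun A B : {set T} => A \subset B) (enum F)) (ground M).

Definition poincare_flag F : {poly rat} :=
  \prod_(k < #|F|.+1)
    poincare (minor_flats (flats M) (nth set0 (flag_seq F) k)
                                    (nth set0 (flag_seq F) k.+1)).

(* The outer variable is T, the inner one is Y. *)
Definition coarse_flag_poly : {poly {poly rat}} :=
  \sum_(F in order_complex proper_flats)
    (poincare_flag F)%:P * 'X^#|F| * (1 - 'X) ^+ (rank.-1 - #|F|).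

(* N_M(1,T) / pi_M(1) *)
Definition normalized_coarse_flag_poly : {poly rat} :=
  ((poincare (flats M)).[1])^-1 *: map_poly (horner_eval 1) coarse_flag_poly.

Definition mclosure A : {set T} := \bigcap_(X in flats M | A \subset X) X.

Definition indep I : bool :=
  (I \subset ground M) && [forall e in I, e \notin mclosure (I :\ e)].

Definition circuits : {set {set T}} :=
  [set C | minset [pred A : {set T} | (A \subset ground M) && ~~ indep A] C].

End Matroid.

Section OrientedMatroid.
Variable T : finType.

(* A signed subset X of T is encoded as the pair (X^+, X^-). *)
Definition signed_set : Type := ({set T} * {set T})%type.
Implicit Types (X Y Z : signed_set).

Definition supp X : {set T} := X.1 :|: X.2.
Definition sopp X : signed_set := (X.2, X.1).

Definition is_signed_circuits (O : {set {set T} * {set T}}) : Prop :=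
  [/\ forall X, X \in O -> [disjoint X.1 & X.2] /\ supp X != set0,
      forall X, X \in O -> sopp X \in O,
      forall X Y, X \in O -> Y \in O -> supp X \subset supp Y ->
        X = Y \/ X = sopp Y
    & forall X Y e, X \in O -> Y \in O -> X <> sopp Y ->
        e \in X.1 :&: Y.2 ->
        exists Z, [/\ Z \in O, Z.1 \subset (X.1 :|: Y.1) :\ e
                            & Z.2 \subset (X.2 :|: Y.2) :\ e]].

Definition orientable (M : matroid T) : Prop :=
  exists2 O : {set {set T} * {set T}},
    is_signed_circuits O & circuits M = [set supp X | X in O].

End OrientedMatroid.

Section SimplicialComplexes.
Variable V : finType.
Implicit Types (K : {set {set V}}).

(* One more than the dimension. *)
Definition complex_size K : nat := \max_(s in K) #|s|.

Definition f_poly K : {poly rat} :=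
  \sum_(k < (complex_size K).+1) #|[set s in K | #|s| == k]|%:R *: 'X^k.

(* (1-T)^d f(K; T/(1-T)) with the denominators cleared. *)
Definition h_poly K : {poly rat} :=
  let d := complex_size K in
  \sum_(k < d.+1) (f_poly K)`_k *: ('X^k * (1 - 'X) ^+ (d - k)).

Definition barycentric_subdivision K : {set {set {set V}}} :=
  order_complex (K :\ set0).

End SimplicialComplexes.

(* The boundary complex of the n-dimensional cross-polytope: (i, true) and
   (i, false) stand for the vertices e_i and - e_i, and a set of vertices is a
   face when it contains no antipodal pair. *)
Definition cross_polytope_boundary (n : nat) : {set {set 'I_n * bool}} :=
  [set s : {set 'I_n * bool} |
    [forall i : 'I_n, ~~ (((i, true) \in s) && ((i, false) \in s))]].

Definition eulerianB (r : nat) : {poly rat} :=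
  h_poly (barycentric_subdivision (cross_polytope_boundary r.-1)).

Definition poly_le (f g : {poly rat}) : Prop := forall i : nat, f`_i <= g`_i.
Definition poly_lt (f g : {poly rat}) : Prop := poly_le f g /\ f <> g.

Definition coef_dist (R : realType) (r : nat) (f g : {poly rat}) : R :=
  Num.sqrt (\sum_(i < r) (ratr f`_i - ratr g`_i) ^+ 2).

Definition flag_bounds (T : finType) (M : matroid T) : Prop :=
  poly_lt ((1 + 'X) ^+ (rank M).-1) (normalized_coarse_flag_poly M) /\
  poly_lt (normalized_coarse_flag_poly M) (eulerianB (rank M)).

(* Main.v *)
Require Import Defs.
From HB Require Import structures.
From mathcomp Require Import all_boot all_order all_algebra.
From mathcomp Require Import reals.
From mathcomp Require boolp topology normedtype sequences.
From mathcomp Require Import ring lra zify.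
Import Order.TTheory GRing.Theory Num.Theory.
Local Open Scope ring_scope.
Set Implicit Arguments.
Unset Strict Implicit.
Unset Printing Implicit Defensive.

(** Let [L] be the lattice of flats of a matroid of rank [r]. For flats X below
    Y write a(X,Y) for the absolute value of the Moebius function of the interval
    ([amu]) and P(X,Y) for the sum of a(X,Z) over the flats Z of the interval
    ([topes]); P(X,Y) is the value at 1 of the Poincare polynomial of the minor,
    so pi_M(1) = P(0,1) with 0 and 1 the bottom and the top of [L]. For an
    oriented matroid P(0,1) is the number of topes, and the products of P along
    flags count flags of faces of topes; all that follows imitates this picture
    inside the incidence algebra of [L].

    Both polynomials to be compared are h-polynomials ([h_of_f]). The k-th face
    number of N_M(1,T)/pi_M(1) is the sum over the flags with k elements of the
    product of P along the flag, divided by pi_M(1)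
    ([normalized_coarse_flag_polyE]); the k-th face number of E_r counts the
    chains of k nonempty faces of the crosspolytope boundary ([eulerianBE]).

    _Upper bounds._ Let A_i be the sum of P(0,X) P(X,1) over the flats X of rank
    i ([face_sum]). For r >= 3 and 0 < i < r the sum A_i is less than
    2^i binom(r-1,i) pi_M(1), the value that cubes would give. The sum of
    a(0,X) a(X,Y) over the X of rank i below Y is at most
    binom(rk Y,i) a(0,Y) ([rank_conv_le]), because Weisner's theorem turns
    induction on Y into the Pascal recursion; summing over i gives
    P(0,X) <= 2^(rk X) a(0,X) ([topes_bot_le]). Since the Moebius function sums
    to zero over an interval, P(X,1) is twice the sum of a(X,Y) over the Y with
    rk Y congruent to r-1 modulo 2 ([topes_parity]); this removes the top, and
    all the binomials that remain are at most binom(r-1,i). Strictness comes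
    from the flats of rank r-3. Adding over i bounds the linear coefficient,
    since the chains of one face are counted by the sum of 2^i binom(r-1,i).

    _Lower bounds._ By the same parity argument A_{r-1} is four times a sum over
    pairs of a flat of the parity of r-1 and a hyperplane above it, so it exceeds
    2 pi_M(1) ([face_sum_coatoms_gt]); for even r one has A_1 >= 2 pi_M(1)
    ([face_sum1_ge]) by the lower half of the convolution estimate.

    _Ranks three and four._ In the incidence algebra P is inverse to P twisted by
    the sign of the rank ([topes_euler]). This is an Euler relation for every
    interval, and it leaves one free face number: the polynomial is 1 + cT + T^2
    with c = 2 A_2 / pi - 2 in rank three, and 1 + cT + cT^2 + T^3 with
    c = 2 A_2 / pi - 1 in rank four ([flag_sum_rk3], [flag_sum_rk4]). The bounds
    on the A_i, with A_1 + A_3 = A_2 + 2 pi in rank four, then decide everything.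

    _Sharpness._ In the uniform matroid U_{r,n} the k-th face number is the
    average of the numbers of k-chains in the crosspolytope boundaries of
    dimension s-1, over the s < r congruent to r-1, with weight binom(n,s)
    ([flag_sum_uniform_top]); for large n the weight of s = r-1 dominates, and
    the limit is E_r. In the matroid of all the vectors of F_p^r the number of
    flats of each rank is a Gaussian binomial, asymptotic to p^(i(r-i)), and
    a(X,Y) is p^binom(k,2) for an interval of length k, so that P is about twice
    that; each element of a flag costs a factor 2, the k-th face number tends to
    2^k binom(r-1,k), and the h-polynomial with these face numbers is
    (1+T)^(r-1) ([h_of_f_cube]). *)

(** * Sums over flags *)

Section ChainSums.
Variables (T : finType) (R : comNzRingType) (w : {set T} -> {set T} -> R).
Implicit Types (X Y Z b : {set T}) (Q C : {set {set T}}).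

(** With [b] and [Y] the bottom and the top flat this is the sequence attached
    to a flag. Leaving [Y] free makes a chain minus its largest element an
    instance of the same notion, with that element as the new [Y]. *)
Definition chain_seq b Y C : seq {set T} :=
  b :: rcons (sort (fun A B : {set T} => A \subset B) (enum C)) Y.

Definition chain_weight b Y C : R :=
  \prod_(k < #|C|.+1)
     w (nth set0 (chain_seq b Y C) k) (nth set0 (chain_seq b Y C) k.+1).

Fixpoint chain_sum Q b k Y : R :=
  if k is k'.+1 then \sum_(X in Q | X \proper Y) chain_sum Q b k' X * w X Y
  else w b Y.

Lemma size_chain_sort C : size (sort (fun A B : {set T} => A \subset B) (enum C)) = #|C|.
Proof. by rewrite size_sort cardE. Qed.

Lemma chain_cover Q C : C \in order_complex Q -> C != set0 -> cover C \in C.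
Proof.
rewrite inE => /andP[_ /forall_inP ch] /set0Pn[A AC].
have [B BC Bmax] : exists2 B, B \in C & forall A, A \in C -> A \subset B.
  case: (arg_maxnP (fun B : {set T} => #|B|) AC) => B BC Bmax; exists B => // D DC.
  have /forall_inP/(_ _ DC) /orP[BD|//] := ch _ BC.
  suff /eqP-> : B == D by [].
  by rewrite eqEcard BD; apply: Bmax.
suff -> : cover C = B by [].
by apply/eqP; rewrite eqEsubset /cover (bigcup_sup B) // andbT; apply/bigcupsP.
Qed.

Lemma is_chainS C C' : C' \subset C -> is_chain C -> is_chain C'.
Proof.
move=> /subsetP CC' /forall_inP ch; apply/forall_inP => A /CC' AC.
by apply/forall_inP => B /CC' BC; move/forall_inP: (ch _ AC); apply.
Qed.

(** An element above a whole chain comes last when the chain is sorted: both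
    sides are sorted permutations of the same set. *)
Lemma chain_sortU C X : is_chain C -> (forall Z, Z \in C -> Z \proper X) ->
  sort (fun A B : {set T} => A \subset B) (enum (X |: C)) =
  rcons (sort (fun A B : {set T} => A \subset B) (enum C)) X.
Proof.
move=> ch CX.
have XC : X \notin C by apply/negP => /CX; rewrite properxx.
set le := fun A B : {set T} => A \subset B.
have letr : transitive le by move=> B A D; apply: subset_trans.
have leanti : antisymmetric le by move=> A B; rewrite -eqEsubset => /eqP.
have sortC D : is_chain D -> sorted le (sort le (enum D)).
  move=> /forall_inP chD; apply: (sort_sorted_in (P := [in D])).
    by move=> A B AD BD; move/forall_inP: (chD _ AD); apply.
  by apply/allP => A; rewrite mem_enum.
apply: (sorted_eq letr leanti).
- apply: sortC; apply/forall_inP => A AX; apply/forall_inP => B BX.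
  move: AX BX; rewrite !inE => /predU1P[->|AC] /predU1P[->|BC].
  + by rewrite subxx.
  + by rewrite (proper_sub (CX _ BC)) orbT.
  + by rewrite (proper_sub (CX _ AC)).
  + by move/forall_inP: ch => /(_ _ AC)/forall_inP; apply.
- rewrite (sorted_pairwise letr) pairwise_rcons -(sorted_pairwise letr) sortC // andbT.
  by apply/allP => A; rewrite mem_sort mem_enum => /CX/proper_sub.
- rewrite perm_sort perm_sym; apply: uniq_perm.
  + by rewrite rcons_uniq mem_sort mem_enum XC sort_uniq enum_uniq.
  + exact: enum_uniq.
  + by move=> A; rewrite mem_rcons !inE mem_sort !mem_enum !inE.
Qed.

Lemma chain_weightU b Y C X : is_chain C -> (forall Z, Z \in C -> Z \proper X) ->
  chain_weight b Y (X |: C) = chain_weight b X C * w X Y.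
Proof.
move=> ch CX.
have XC : X \notin C by apply/negP => /CX; rewrite properxx.
rewrite /chain_weight cardsU1 XC add1n big_ord_recr /=; congr (_ * _).
  apply: eq_bigr => k _; have kC := ltn_ord k.
  rewrite /chain_seq chain_sortU //; set s := sort _ _.
  have ss : size s = #|C| by apply: size_chain_sort.
  have nE j : (j < #|C|.+2)%N ->
      nth set0 (b :: rcons (rcons s X) Y) j = nth set0 (b :: rcons s X) j.
    by case: j => [|j] jC //=; rewrite nth_rcons size_rcons ss (jC : (j < #|C|.+1)%N).
  by have -> := nE k (ltnW kC); have /= -> := nE k.+1 kC.
rewrite chain_sortU //=; set s := sort _ _.
have ss : size s = #|C| by apply: size_chain_sort.
by rewrite -!ss -{1}(size_rcons s X) !nth_rcons !size_rcons !ltnn !eqxx ltnSn.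
Qed.

Lemma chain_weight0 b Y : chain_weight b Y set0 = w b Y.
Proof.
rewrite /chain_weight /chain_seq cards0 big_ord1 /=.
have : size (sort (fun A B : {set T} => A \subset B) (enum (@set0 {set T}))) = 0%N.
  by rewrite size_chain_sort cards0.
by case: sort.
Qed.

(** A nonempty chain is determined by its largest element, which is the union
    of its members, and by the chain of the others. *)
Lemma sum_chain_weight Q b k Y :
  \sum_(C in order_complex [set X in Q | X \proper Y] | #|C| == k)
     chain_weight b Y C = chain_sum Q b k Y.
Proof.
elim: k Y => [|k IHk] Y /=.
  rewrite (big_pred1 set0) ?chain_weight0 // => C.
  rewrite cards_eq0 /= andbC; case: eqP => //= ->.
  by rewrite inE sub0set; apply/forall_inP => A; rewrite inE.
pose QY := [set X in Q | X \proper Y].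
rewrite (partition_big (fun C : {set {set T}} => cover C) (fun X => X \in QY)) /=; last first.
  move=> C /andP[CQ Ck]; have CQY : C \subset QY by move: CQ; rewrite inE => /andP[].
  by apply: (subsetP CQY); apply: (chain_cover CQ); rewrite -cards_eq0 (eqP Ck).
rewrite (eq_bigl (fun X => (X \in Q) && (X \proper Y))); last by move=> X; rewrite inE.
apply: eq_bigr => X /andP[XQ XY]; rewrite -IHk mulr_suml.
rewrite (reindex_onto (fun C => X |: C) (fun C => C :\ X)) /=; last first.
  move=> C /andP[/andP[CQ Ck] /eqP CX]; apply: setD1K; rewrite -CX.
  by apply: (chain_cover CQ); rewrite -cards_eq0 (eqP Ck).
have subX C : C \in order_complex [set Z in Q | Z \proper X] ->
    is_chain C /\ forall Z, Z \in C -> (Z \in Q) && (Z \proper X).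
  by rewrite inE => /andP[/subsetP CQ ch]; split => // Z /CQ; rewrite inE.
apply: eq_big => [C|C].
  apply/idP/idP.
    move=> /andP[/andP[/andP[CQ Ck] /eqP CX] /eqP XK].
    have XnC : X \notin C by rewrite -XK !inE eqxx.
    move: Ck; rewrite cardsU1 XnC add1n eqSS => ->; rewrite andbT.
    move: CQ; rewrite !inE => /andP[/subsetP CQ ch]; apply/andP; split; last first.
      by apply: is_chainS ch; apply: subsetUr.
    apply/subsetP => Z ZC; have := CQ Z; rewrite !inE ZC orbT => /(_ isT)/andP[-> _] /=.
    rewrite properEneq; apply/andP; split; first by apply: contraNneq XnC => <-.
    by rewrite -CX /cover (bigcup_sup Z) // !inE ZC orbT.
  move=> /andP[/subX[ch CX] /eqP Ck].
  have XnC : X \notin C by apply/negP => /CX; rewrite properxx andbF.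
  rewrite cardsU1 XnC add1n Ck eqxx andbT setU1K // eqxx andbT.
  apply/andP; split; last first.
    rewrite eqEsubset /cover (bigcup_sup X) ?setU11 // andbT; apply/bigcupsP => Z.
    by rewrite !inE => /predU1P[->//|/CX/andP[_ /proper_sub]].
  rewrite inE; apply/andP; split.
    apply/subsetP => Z; rewrite !inE => /predU1P[->|/CX/andP[->]]; first by rewrite XQ.
    by move=> /proper_trans; apply.
  apply/forall_inP => A AX; apply/forall_inP => B BX.
  move: AX BX; rewrite !inE => /predU1P[->|AC] /predU1P[->|BC].
  + by rewrite subxx.
  + by have /andP[_ /proper_sub->] := CX _ BC; rewrite orbT.
  + by have /andP[_ /proper_sub->] := CX _ AC.
  + by move/forall_inP: ch => /(_ _ AC)/forall_inP; apply.
move=> /andP[/andP[/andP[CQ Ck] /eqP CX] /eqP XK].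
have XnC : X \notin C by rewrite -XK !inE eqxx.
apply: chain_weightU.
  by move: CQ; rewrite !inE => /andP[_]; apply: is_chainS; apply: subsetUr.
move=> Z ZC; rewrite properEneq; apply/andP; split; first by apply: contraNneq XnC => <-.
by rewrite -CX /cover (bigcup_sup Z) // !inE ZC orbT.
Qed.

End ChainSums.

(** * Flats, joins and rank *)

Lemma odd_pred_le a n : (0 < n)%N -> (a <= n)%N -> odd a = odd n.-1 -> (a <= n.-1)%N.
Proof. lia. Qed.

Section Flats.
Variables (T : finType) (E : {set T}) (L : {set {set T}}).
Hypothesis LP : is_flats E L.
Implicit Types (F G H X Y Z : {set T}) (C : {set {set T}}).

Lemma flat_sub F : F \in L -> F \subset E.
Proof. by case: LP => + _ _ _; apply. Qed.

Lemma ground_flat : E \in L.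
Proof. by case: LP. Qed.

Lemma flatI F G : F \in L -> G \in L -> F :&: G \in L.
Proof. by case: LP => _ _ + _; apply. Qed.

Lemma flat_bigcap (P : pred {set T}) : P E -> \bigcap_(G in L | P G) G \in L.
Proof.
move=> PE; rewrite -[X in X \in L](setIidPr (_ : _ \subset E)); last first.
  by apply: (bigcap_inf E); rewrite ground_flat PE.
apply: (big_ind (fun A => E :&: A \in L)).
- by rewrite setIT ground_flat.
- by move=> A B AL BL; rewrite -(setIid E) setIACA flatI.
- by move=> G /andP[GL _]; rewrite flatI // ground_flat.
Qed.

Lemma bot_flat : bot L \in L.
Proof.
rewrite /bot; have := @flat_bigcap predT isT.
by rewrite (eq_bigl (mem L)) // => G /=; rewrite andbT.
Qed.

Lemma bot_sub F : F \in L -> bot L \subset F.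
Proof. by move=> FL; apply: (bigcap_inf F). Qed.

(** The join of a flat with a point, that is, the closure of [e |: F]. *)
Definition jn F e : {set T} := \bigcap_(G in L | e |: F \subset G) G.

Lemma jn_min F G e : G \in L -> F \subset G -> e \in G -> jn F e \subset G.
Proof.
by move=> GL FG eG; apply: (bigcap_inf G) => //; rewrite GL subUset sub1set eG.
Qed.

Lemma sub_jn F e : F \subset jn F e.
Proof.
by apply/bigcapsP => G /andP[_ /(subset_trans _)]; apply; apply: subsetUr.
Qed.

Lemma mem_jn F e : e \in jn F e.
Proof. by apply/bigcapP => G /andP[_ /subsetP]; apply; apply: setU11. Qed.

Lemma jn_flat F e : F \in L -> e \in E -> jn F e \in L.
Proof.
by move=> FL eE; apply: flat_bigcap; rewrite subUset sub1set eE flat_sub.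
Qed.

Lemma jn_id F e : F \in L -> e \in F -> jn F e = F.
Proof. by move=> FL eF; apply/eqP; rewrite eqEsubset sub_jn jn_min. Qed.

Lemma jnS F G e : F \subset G -> G \in L -> e \in E -> jn F e \subset jn G e.
Proof.
move=> FG GL eE; apply: jn_min (mem_jn _ _); first exact: jn_flat.
exact: subset_trans FG (sub_jn _ _).
Qed.

Lemma proper_jn F e : e \notin F -> F \proper jn F e.
Proof. by move=> eF; apply/properP; split; [exact: sub_jn | exists e => //; exact: mem_jn]. Qed.

(** The flat covering [F] through [e] that the axioms provide contains the
    join, and nothing lies strictly between, so it is the join. *)
Lemma jn_cover F H e : F \in L -> e \in E -> e \notin F -> H \in L ->
  F \proper H -> H \subset jn F e -> H = jn F e.
Proof.
move=> FL eE eF HL FH HJ.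
case: LP => _ _ _ /(_ F e FL); rewrite inE eE eF => /(_ isT) [G [[[_ GL FG Gcov] eG] _]].
have JG : jn F e \subset G by rewrite jn_min // proper_sub.
have HG : H = G.
  by apply/eqP; have := Gcov _ HL FH; rewrite properE eqEsubset (subset_trans HJ JG) negbK.
by apply/eqP; rewrite eqEsubset HJ HG JG.
Qed.

Lemma jn_exchange F G e : F \in L -> G \in L -> F \proper G -> e \in E -> e \notin G ->
  ~~ (G \subset jn F e).
Proof.
move=> FL GL FG eE eG; apply/negP => GJ.
have eF : e \notin F by apply: contra eG; apply/subsetP/proper_sub.
by move: eG; rewrite (jn_cover FL eE eF GL FG GJ) mem_jn.
Qed.

Lemma covers_jn F G e : covers L F G -> e \in G -> e \notin F -> G = jn F e.
Proof.
move=> [FL GL FG Gcov] eG eF; have eE := subsetP (flat_sub GL) _ eG.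
have JG : jn F e \subset G by rewrite jn_min // proper_sub.
have := Gcov _ (jn_flat FL eE) (proper_jn eF); rewrite properE JG negbK => GJ.
by apply/eqP; rewrite eqEsubset GJ.
Qed.

Lemma jn_covers F e : F \in L -> e \in E -> e \notin F -> covers L F (jn F e).
Proof.
move=> FL eE eF; split=> //; [exact: jn_flat | exact: proper_jn|].
move=> H HL FH; apply/negP => HJ; move: (HJ).
by rewrite (jn_cover FL eE eF HL FH (proper_sub HJ)) properxx.
Qed.

Definition between X Y : {set {set T}} :=
  [set Z in L | (X \subset Z) && (Z \subset Y)].

Lemma betweenE X Y Z : (Z \in between X Y) = [&& Z \in L, X \subset Z & Z \subset Y].
Proof. by rewrite inE. Qed.

Lemma between_xx X : X \in L -> between X X = [set X].
Proof.
move=> XL; apply/setP => Z; rewrite betweenE in_set1 eqEsubset [RHS]andbC.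
apply/and3P/andP => [[_ -> ->]//|[XZ ZX]]; split=> //.
by have -> : Z = X by apply/eqP; rewrite eqEsubset ZX.
Qed.

(** [len X Y] counts the elements of a longest chain from [X] to [Y]; the rank
    is one less than this for [X] the bottom. The general [X] serves the
    induction from below that shows that [len] grows by one along covers. *)
Definition len X Y : nat := \max_(C in order_complex (between X Y)) #|C|.

Lemma order_complexP (Q C : {set {set T}}) :
  reflect ({subset C <= Q} /\ {in C &, forall A B : {set T}, (A \subset B) || (B \subset A)})
          (C \in order_complex Q).
Proof.
rewrite inE; apply: (iffP andP) => [[/subsetP CQ /forall_inP ch]|[CQ ch]]; split => //.
- by move=> A B CA CB; move/forall_inP: (ch _ CA); apply.
- exact/subsetP.
- by apply/forall_inP => A CA; apply/forall_inP => B CB; apply: ch.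
Qed.

Lemma len_ge X Y C : C \in order_complex (between X Y) -> (#|C| <= len X Y)%N.
Proof. by move=> CX; rewrite /len (bigD1 C) //= leq_maxl. Qed.

Lemma len_attained X Y :
  exists2 C, C \in order_complex (between X Y) & #|C| = len X Y.
Proof.
have [|C CX lenE] := @eq_bigmax_cond _ (mem (order_complex (between X Y)))
    (fun C : {set {set T}} => #|C|); last by exists C.
apply/card_gt0P; exists set0; apply/order_complexP; split; first by move=> A; rewrite inE.
by move=> A B; rewrite inE.
Qed.

(** Jordan-Hoelder step: joining all members of a chain with [e] identifies at
    most two of them. Members that contain [e] are fixed; two that avoid it have
    different joins because [F] is covered by [jn F e]; and the join of an
    avoiding member can meet the fixed ones only for the largest avoiding
    member. *)
Lemma chain_jn_card X Y e C : Y \in L -> e \in E ->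
  C \in order_complex (between X Y) ->
  (#|C| <= #|[set jn Z e | Z in C]|.+1)%N.
Proof.
move=> YL eE /order_complexP[CXY ch].
have CL Z : Z \in C -> Z \in L by move/CXY; rewrite betweenE => /and3P[].
pose C0 := [set Z in C | e \notin Z]; pose C1 := [set Z in C | e \in Z].
have CE : C = C0 :|: C1 by apply/setP => Z; rewrite !inE; case: (e \in Z); rewrite ?andbT ?andbF ?orbF.
have C0P Z : Z \in C0 -> Z \in C /\ e \notin Z by rewrite inE => /andP[].
have C1P Z : Z \in C1 -> Z \in C /\ e \in Z by rewrite inE => /andP[].
have le0 Z Z' : Z \in C0 -> Z' \in C0 -> Z' \subset jn Z e -> Z' \subset Z.
  move=> /C0P[ZC eZ] /C0P[ZC' eZ'] Z'J; have /orP[ZZ'|//] := ch _ _ ZC ZC'.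
  apply: contraTT Z'J => nZ'Z; apply: jn_exchange => //; try exact: CL.
  by rewrite properE ZZ'.
pose J := [set jn Z e | Z in C0].
have imE : [set jn Z e | Z in C] = J :|: C1.
  rewrite {1}CE imsetU; congr (_ :|: _); rewrite -[RHS]imset_id.
  by apply: eq_in_imset => Z /C1P[/CL ZL eZ]; apply: jn_id.
have Jinj : {in C0 &, injective (jn^~ e)}.
  move=> Z Z' Z0 Z0' JJ; apply/eqP; rewrite eqEsubset; apply/andP; split.
    by apply: (le0 Z' Z Z0' Z0); rewrite -[jn Z' e]JJ; apply: sub_jn.
  by apply: (le0 Z Z' Z0 Z0'); rewrite [jn Z e]JJ; apply: sub_jn.
(* Only the largest member avoiding e can have its join in the chain. *)
have JC1 : (#|J :&: C1| <= 1)%N.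
  apply/card_le1_eqP => _ _ /setIP[/imsetP[Z Z0 ->] J1] /setIP[/imsetP[Z' Z0' ->] J1'].
  have key V V' : V \in C0 -> V' \in C0 -> jn V e \in C1 -> jn V' e \in C1 -> V' \subset V.
    move=> V0 V0' V1 V1'; apply: (le0) => //.
    have [[VC' eV'] [JC eJ]] := (C0P _ V0', C1P _ V1).
    by have /orP[//|/subsetP/(_ _ eJ)] := ch _ _ VC' JC; rewrite (negPf eV').
  by congr jn; apply/eqP; rewrite eqEsubset !key.
have C01 : #|C| = (#|C0| + #|C1|)%N.
  rewrite {1}CE cardsU; have -> : C0 :&: C1 = set0; last by rewrite cards0 subn0.
  by apply/setP => Z; rewrite !inE; case: (e \in Z); rewrite ?andbF.
rewrite imE C01 -(card_in_imset Jinj) -/J -addn1.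
by rewrite -cardsUI leq_add2l.
Qed.

Lemma len_jn X Y e : X \in L -> Y \in L -> X \subset Y -> e \in Y -> e \notin X ->
  len X Y = (len (jn X e) Y).+1.
Proof.
move=> XL YL XY eY eX; have eE := subsetP (flat_sub YL) _ eY.
have JL := jn_flat XL eE; have JY := jn_min YL XY eY.
apply/eqP; rewrite eqn_leq; apply/andP; split; last first.
  have [C /order_complexP[CJ ch] <-] := len_attained (jn X e) Y.
  have CP Z : Z \in C -> [/\ Z \in L, X \subset Z, Z \subset Y & jn X e \subset Z].
    move/CJ; rewrite betweenE => /and3P[-> JZ ->]; split=> //.
    exact: subset_trans (sub_jn _ _) JZ.
  have XC : X \notin C.
    by apply/negP => /CP[_ _ _ /subsetP/(_ _ (mem_jn X e))]; rewrite (negPf eX).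
  have -> : #|C|.+1 = #|X |: C| by rewrite cardsU1 XC.
  apply: len_ge; apply/order_complexP; split.
    by move=> Z; rewrite betweenE => /setU1P[->|/CP[-> -> ->]//]; rewrite XL subxx.
  move=> A B /setU1P[->|CA] /setU1P[->|CB].
  - by rewrite subxx.
  - by have [_ ->] := CP _ CB.
  - by have [_ ->] := CP _ CA; rewrite orbT.
  - exact: ch.
have [C CX <-] := len_attained X Y.
apply: leq_trans (chain_jn_card YL eE CX) _; rewrite ltnS; apply: len_ge.
move/order_complexP: CX => [CXY ch]; apply/order_complexP; split.
  move=> _ /imsetP[Z /CXY + ->]; rewrite !betweenE => /and3P[ZL XZ ZY].
  by rewrite jn_flat // jnS // jn_min.
have CL Z : Z \in C -> Z \in L by move/CXY; rewrite betweenE => /and3P[].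
move=> _ _ /imsetP[A CA ->] /imsetP[B CB ->].
by have /orP[H|H] := ch _ _ CA CB; apply/orP; [left|right]; apply: jnS; rewrite ?CL.
Qed.

Lemma len_gt0 X Y : X \in L -> X \subset Y -> (0 < len X Y)%N.
Proof.
move=> XL XY; rewrite -(cards1 X); apply: len_ge; apply/order_complexP; split.
  by move=> Z /set1P->; rewrite betweenE XL subxx.
by move=> A B /set1P-> /set1P->; rewrite subxx.
Qed.

Lemma len_xx X : X \in L -> len X X = 1%N.
Proof.
move=> XL; apply/eqP; rewrite eqn_leq len_gt0 // andbT.
apply/bigmax_leqP => C /order_complexP[CX _].
by rewrite -(cards1 X) subset_leq_card // -between_xx //; apply/subsetP.
Qed.

(** The growth at the top follows from the growth at the bottom by walking up
    from [X] to [F]. *)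
Lemma len_jn_top X F e : X \in L -> F \in L -> X \subset F -> e \in E -> e \notin F ->
  len X (jn F e) = (len X F).+1.
Proof.
move=> + FL + eE eF.
have [n] := ubnP (#|F| - #|X|)%N; elim: n X => // n IHn X Fn XL XF.
have [FX|nFX] := boolP (F \subset X).
  have -> : X = F by apply/eqP; rewrite eqEsubset XF.
  by rewrite (len_jn (e := e)) ?sub_jn ?mem_jn ?jn_flat // !len_xx ?jn_flat.
have [f fF fX] := subsetPn nFX.
have fE := subsetP (flat_sub FL) _ fF.
have XJ := subset_trans XF (sub_jn F e).
rewrite (len_jn (e := f) XL _ XJ) ?jn_flat ?(subsetP (sub_jn F e) f fF) //.
rewrite (len_jn XL FL XF fF fX) IHn ?jn_flat ?jn_min //.
apply: leq_trans (ltn_sub2l _ _) _; last exact: Fn.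
  by rewrite proper_card // properE XF.
by rewrite proper_card // proper_jn.
Qed.

Lemma rkE F : F \in L -> rk L F = (len (bot L) F).-1.
Proof.
move=> FL; rewrite /rk /len; congr (_.-1).
suff -> : [set Z in L | Z \subset F] = between (bot L) F by [].
by apply/setP => Z; rewrite !inE; case: (boolP (Z \in L)) => //= /bot_sub ->.
Qed.

Lemma rk_bot : rk L (bot L) = 0%N.
Proof. by rewrite rkE ?len_xx ?bot_flat. Qed.

Lemma rk_jn F e : F \in L -> e \in E -> e \notin F -> rk L (jn F e) = (rk L F).+1.
Proof.
move=> FL eE eF; rewrite !rkE ?jn_flat // len_jn_top ?bot_flat ?bot_sub //=.
by rewrite prednK // len_gt0 ?bot_flat ?bot_sub.
Qed.

Lemma rk_covers F G : covers L F G -> rk L G = (rk L F).+1.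
Proof.
move=> FG; have [FL GL /properP[_ [e eG eF]] _] := FG.
by rewrite (covers_jn FG eG eF) rk_jn // (subsetP (flat_sub GL)).
Qed.

(** Downward induction on the flats below [Y], one cover at a time. *)
Lemma flat_lt_ind (P : {set T} -> Prop) Y : Y \in L ->
  (forall X, X \in L -> X \subset Y ->
     (forall e, e \in Y -> e \notin X -> P (jn X e)) -> P X) ->
  forall X, X \in L -> X \subset Y -> P X.
Proof.
move=> YL IH X; have [n] := ubnP (#|Y| - #|X|)%N.
elim: n X => // n IHn X Xn XL XY; apply: IH => // e eY eX.
have eE := subsetP (flat_sub YL) _ eY.
apply: IHn; rewrite ?jn_flat ?jn_min //.
apply: leq_trans (ltn_sub2l _ _) _; last exact: Xn.
  by rewrite proper_card // properE XY; apply/subsetPn; exists e.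
by rewrite proper_card // proper_jn.
Qed.

Section Graded.
Variable rho : {set T} -> nat.
Hypothesis rho_covers : forall F G, covers L F G -> rho G = (rho F).+1.

Lemma graded_jn F e : F \in L -> e \in E -> e \notin F -> rho (jn F e) = (rho F).+1.
Proof. by move=> FL eE eF; apply/rho_covers/jn_covers. Qed.

Lemma graded_le X Y : X \in L -> Y \in L -> X \subset Y -> (rho X <= rho Y)%N.
Proof.
move=> XL YL XY; move: X XL XY; apply: flat_lt_ind => // X XL XY IH.
have [YX|/subsetPn[e eY eX]] := boolP (Y \subset X).
  by have -> : X = Y by apply/eqP; rewrite eqEsubset XY.
apply: leq_trans (IH e eY eX); rewrite graded_jn ?leqnSn //.
exact: (subsetP (flat_sub YL)).
Qed.

Lemma graded_lt X Y : X \in L -> Y \in L -> X \proper Y -> (rho X < rho Y)%N.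
Proof.
move=> XL YL /properP[XY [e eY eX]]; have eE := subsetP (flat_sub YL) _ eY.
by rewrite -(graded_jn XL eE eX) graded_le ?jn_flat ?jn_min.
Qed.

Lemma graded_between X Y j : X \in L -> Y \in L -> X \subset Y ->
  (rho X <= j <= rho Y)%N -> exists2 Z, Z \in between X Y & rho Z = j.
Proof.
move=> XL YL XY; move: X XL XY; apply: flat_lt_ind => // X XL XY IH.
case/andP; rewrite leq_eqVlt => /predU1P[<- _|Xj jY].
  by exists X; rewrite // betweenE XL subxx.
have /subsetPn[e eY eX] : ~~ (Y \subset X).
  apply/negP => YX; move: (leq_trans Xj jY).
  by have -> : X = Y by [apply/eqP; rewrite eqEsubset XY]; rewrite ltnn.
have eE := subsetP (flat_sub YL) _ eY.
have [|Z ZI Zj] := IH e eY eX; first by rewrite graded_jn // Xj.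
by exists Z => //; move: ZI; rewrite !betweenE => /and3P[-> /(subset_trans (sub_jn _ _))->].
Qed.

(** A function that increases by one along covers is the rank up to an
    additive constant. This computes the ranks of minors, of uniform matroids
    and of vector spaces without exhibiting longest chains. *)
Lemma graded_len X Y : X \in L -> Y \in L -> X \subset Y ->
  (len X Y + rho X)%N = (rho Y).+1.
Proof.
move=> XL YL XY; move: X XL XY; apply: flat_lt_ind => // X XL XY IH.
have [YX|/subsetPn[e eY eX]] := boolP (Y \subset X).
  by have -> : X = Y; [apply/eqP; rewrite eqEsubset XY | rewrite len_xx].
have eE := subsetP (flat_sub YL) _ eY.
by rewrite (len_jn XL YL XY eY eX) addSnnS -(graded_jn XL eE eX) IH.
Qed.

Lemma graded_rk X : rho (bot L) = 0%N -> X \in L -> rk L X = rho X.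
Proof.
move=> rho0 XL; rewrite rkE //.
by have := graded_len bot_flat XL (bot_sub XL); rewrite rho0 addn0 => ->.
Qed.

End Graded.

Definition rk_le := graded_le rk_covers.
Definition rk_lt := graded_lt rk_covers.
Definition rk_between := graded_between rk_covers.

Lemma rk_inj X Y : X \in L -> Y \in L -> X \subset Y -> rk L X = rk L Y -> X = Y.
Proof.
move=> XL YL XY rXY; apply/eqP; rewrite eqEsubset XY; apply/negPn/negP => YX.
by have := rk_lt XL YL; rewrite properE XY YX rXY ltnn => /(_ isT).
Qed.

(** * The Moebius function of the intervals *)

(** The restriction of [L] to the flats above [X] has bottom [X], so its Moebius
    function is the one of the intervals that start at [X]. *)
Definition mu X Y : rat := (mobius [set Z in L | X \subset Z] Y)%:~R.

Lemma up_bot X : X \in L -> bot [set Z in L | X \subset Z] = X.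
Proof.
move=> XL; apply/eqP; rewrite eqEsubset; apply/andP; split.
  by apply: (bigcap_inf X); rewrite inE XL subxx.
by apply/bigcapsP => Z; rewrite inE => /andP[].
Qed.

Lemma mu_xx X : X \in L -> mu X X = 1.
Proof. by move=> XL; rewrite /mu -{2}(up_bot XL) mobius_bot. Qed.

Lemma between_top X Y (R : nmodType) (f : {set T} -> R) : Y \in L -> X \subset Y ->
  \sum_(Z in between X Y) f Z = f Y + \sum_(Z in between X Y | Z \proper Y) f Z.
Proof.
move=> YL XY; rewrite (bigD1 Y) ?betweenE ?YL ?XY ?subxx //=; congr (_ + _).
apply: eq_bigl => Z; rewrite betweenE properEneq.
by case: (Z \subset Y); rewrite ?andbF ?andbT.
Qed.

Lemma mu_sum X Y : X \in L -> Y \in L -> X \proper Y ->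
  \sum_(Z in between X Y) mu X Z = 0.
Proof.
move=> XL YL XY; rewrite between_top ?proper_sub // {1}/mu mobius_rec; last first.
  by rewrite up_bot // eq_sym; move: XY; rewrite properEneq => /andP[].
rewrite rmorphN rmorph_sum /= addrC; apply/eqP; rewrite subr_eq0; apply/eqP.
apply: eq_bigl => Z; rewrite !inE.
by case: (boolP (Z \proper Y)) => [/proper_sub->|]; rewrite ?andbF ?andbT.
Qed.

Lemma mu_sum_eq X Y : X \in L -> Y \in L -> X \subset Y ->
  \sum_(Z in between X Y) mu X Z = (X == Y)%:R.
Proof.
move=> XL YL XY; case: eqVneq => [<-|XnY].
  by rewrite between_xx // big_set1 mu_xx.
by rewrite mu_sum // properEneq XnY.
Qed.

(** A left inverse of the zeta function is a right inverse. Summing the claim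
    over all upper ends below [Y] gives 1, by exchanging the sums; by induction
    the terms other than [X] and [Y] vanish, hence so does the last one. *)
Lemma mu_dual X Y : X \in L -> Y \in L -> X \subset Y ->
  \sum_(Z in between X Y) mu Z Y = (X == Y)%:R.
Proof.
move=> XL; have [n] := ubnP #|Y|; elim: n Y => // n IHn Y Yn YL XY.
(* The total of the claimed identities over the upper ends Z in [X, Y]. *)
have: \sum_(Z in between X Y) \sum_(W in between X Z) mu W Z = 1.
  rewrite (exchange_big_dep (mem (between X Y))) /=; last first.
    move=> Z W; rewrite !betweenE => /and3P[_ _ ZY] /and3P[-> -> WZ].
    exact: subset_trans WZ ZY.
  rewrite (eq_bigr (fun W => (W == Y)%:R)).
    rewrite (bigD1 Y) /=; last by rewrite betweenE YL XY subxx.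
    by rewrite eqxx big1 ?addr0 // => W /andP[_ /negPf->].
  move=> W; rewrite betweenE => /and3P[WL XW WY]; rewrite -mu_sum_eq //.
  apply: eq_bigl => Z; rewrite !betweenE WL XW /=.
  by apply/andP/and3P => [[/and3P[-> _ ->] ->]//|[ZL WZ ->]]; rewrite ZL WZ (subset_trans XW).
case: (eqVneq X Y) => [<- _|XnY].
  by rewrite between_xx // big_set1 mu_xx.
rewrite between_top // [Z in _ + Z](bigD1 X) /=; last by rewrite betweenE XL subxx XY properEneq XnY XY.
rewrite between_xx // big_set1 mu_xx // [Z in _ + (_ + Z)]big1 ?addr0 => [/(canRL (addrK _))|Z].
  by rewrite subrr.
rewrite betweenE => /andP[/andP[/and3P[ZL XZ _] ZY] ZX].
rewrite IHn ?(eq_sym X) ?(negPf ZX) //.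
exact: leq_trans (proper_card ZY) _.
Qed.

(** Weisner's theorem for the join with a point: sorting the flats Z of the
    interval by their join with [e] splits a vanishing sum into the sums for the
    joins V, which vanish by induction except for V = Y. *)
Lemma weisner_mu X Y e : X \in L -> Y \in L -> X \subset Y -> e \in Y -> e \notin X ->
  \sum_(Z in between X Y | jn Z e == Y) mu X Z = 0.
Proof.
move=> XL + + + eX; have [n] := ubnP #|Y|; elim: n Y => // n IHn Y Yn YL XY eY.
have eE := subsetP (flat_sub YL) _ eY.
have XpY : X \proper Y by apply/properP; split => //; exists e.
have := mu_sum XL YL XpY.
rewrite (partition_big (fun Z => jn Z e) (mem (between (jn X e) Y))) /=; last first.
  move=> Z; rewrite !betweenE => /and3P[ZL XZ ZY].
  by rewrite jn_flat ?jnS ?jn_min.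
rewrite between_top ?jn_min // [Z in _ + Z]big1 ?addr0 // => V /andP[].
rewrite betweenE => /and3P[VL JV _] VY.
have eV : e \in V by apply: (subsetP JV); apply: mem_jn.
rewrite -[RHS](IHn V) //; last 2 first.
- exact: leq_trans (proper_card VY) _.
- exact: subset_trans (sub_jn _ _) JV.
apply: eq_bigl => Z; rewrite !betweenE.
case: (eqVneq (jn Z e) V) => [JZ|]; rewrite ?andbF ?andbT //.
have ZV : Z \subset V by rewrite -JZ sub_jn.
by rewrite ZV (subset_trans ZV (proper_sub VY)).
Qed.

(** The flats that occur in Weisner's theorem apart from [Y] itself: [Y] covers
    each of them. *)
Definition co e Y : {set {set T}} := [set H in L | (e \notin H) && (jn H e == Y)].

Lemma coP e Y H : e \in E -> H \in co e Y ->
  [/\ H \in L, e \notin H, H \proper Y & rk L Y = (rk L H).+1].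
Proof.
move=> eE; rewrite inE => /and3P[HL eH /eqP<-].
by split; rewrite ?proper_jn ?rk_jn.
Qed.

Lemma co_bot e Y H : e \in E -> (H \in co e Y) && (bot L \subset H) = (H \in co e Y).
Proof. by move=> eE; case: (boolP (H \in co e Y)) => [/(coP eE)[/bot_sub->]|]. Qed.

(** The absolute value of the Moebius function, by the sign theorem of Rota that
    [amu_ge1] contains. Adding the ranks instead of subtracting them gives the
    same sign and avoids truncation. *)
Definition amu X Y : rat := (-1) ^+ (rk L X + rk L Y) * mu X Y.

Lemma amu_xx X : X \in L -> amu X X = 1.
Proof. by move=> XL; rewrite /amu mu_xx // mulr1 addnn -mul2n exprM sqrrN !expr1n. Qed.

Lemma amuE X Y : mu X Y = (-1) ^+ (rk L X + rk L Y) * amu X Y.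
Proof. by rewrite mulrA -exprD addnn -mul2n exprM sqrrN !expr1n mul1r. Qed.

(** With signs removed Weisner's theorem is a recursion with positive terms; all
    estimates below are inductions along it. *)
Lemma weisner X Y e : X \in L -> Y \in L -> X \subset Y -> e \in Y -> e \notin X ->
  amu X Y = \sum_(H in co e Y | X \subset H) amu X H.
Proof.
move=> XL YL XY eY eX; have eE := subsetP (flat_sub YL) _ eY.
have := weisner_mu XL YL XY eY eX.
rewrite (bigD1 Y) ?betweenE ?YL ?XY ?subxx ?jn_id ?eqxx //=.
rewrite /amu => /eqP; rewrite addr_eq0 => /eqP->; rewrite mulrN -mulNr mulr_sumr.
apply: eq_big => [Z|Z].
  rewrite inE [in RHS]inE; case: (boolP (Z \in L)) => //= ZL.
  case: (boolP (X \subset Z)) => XZ; rewrite ?andbF //= andbT.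
  case: (eqVneq (jn Z e) Y) => [<-|]; rewrite ?andbF // sub_jn /= andbT.
  apply/idP/idP => [ZJ|eZ]; last by have := proper_jn eZ; rewrite properEneq => /andP[].
  by apply: contra ZJ => eZ; rewrite jn_id.
rewrite betweenE => /andP[/andP[/and3P[ZL XZ ZY] /eqP ZJ] ZnY].
have eZ : e \notin Z by apply: contra ZnY => eZ; rewrite -ZJ jn_id.
by congr (_ * _); rewrite -ZJ rk_jn // addnS exprS mulN1r opprK.
Qed.

(** A largest flat between [X] and [Y] that avoids [e]. *)
Lemma co_above X Y e : X \in L -> Y \in L -> X \subset Y -> e \in Y -> e \notin X ->
  exists2 H, H \in co e Y & X \subset H.
Proof.
move=> XL YL XY eY eX; have eE := subsetP (flat_sub YL) _ eY.
have X0 : (X \in between X Y) && (e \notin X) by rewrite betweenE XL subxx XY.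
have [H /andP[]] := @arg_maxnP _ X (fun H => (H \in between X Y) && (e \notin H))
  (fun H : {set T} => #|H|) X0.
rewrite betweenE => /and3P[HL XH HY] eH Hmax; exists H => //.
rewrite inE HL eH eqEsubset jn_min //=; apply/subsetP => f fY.
have fE := subsetP (flat_sub YL) _ fY.
have [fH|fH] := boolP (f \in H); first by apply: (subsetP (sub_jn _ _)).
suff -> : jn H e = jn H f by apply: mem_jn.
apply: jn_cover => //; [exact: jn_flat|exact: proper_jn|].
apply: jn_min; [exact: jn_flat|exact: sub_jn|apply: contraT => eJ].
have := Hmax (jn H f); rewrite eJ betweenE jn_flat ?jn_min ?(subset_trans XH) ?sub_jn //.
by move=> /(_ isT); rewrite /= leqNgt proper_card ?proper_jn.
Qed.

Lemma amu_ge1 X Y : X \in L -> Y \in L -> X \subset Y -> 1 <= amu X Y.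
Proof.
move=> XL; have [n] := ubnP #|Y|; elim: n Y => // n IHn Y Yn YL XY.
have [YX|/subsetPn[e eY eX]] := boolP (Y \subset X).
  by have -> : Y = X; [apply/eqP; rewrite eqEsubset XY YX | rewrite amu_xx].
have eE := subsetP (flat_sub YL) _ eY.
have IH H : (H \in co e Y) && (X \subset H) -> 1 <= amu X H.
  move=> /andP[/(coP eE)[HL _ HY _] XH]; apply: IHn => //.
  exact: leq_trans (proper_card HY) _.
have [H HY XH] := co_above XL YL XY eY eX.
rewrite (weisner XL YL XY eY eX) (bigD1 H) /= ?HY // -[1]addr0 lerD ?IH ?HY //.
by apply: sumr_ge0 => H' /andP[/IH H1 _]; apply: le_trans H1.
Qed.

Lemma amu_ge0 X Y : X \in L -> Y \in L -> X \subset Y -> 0 <= amu X Y.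
Proof. by move=> XL YL XY; apply: le_trans (amu_ge1 XL YL XY). Qed.

(** In the Weisner recursion at a point outside [X1], the terms for [X1] are
    among those for [X]. *)
Lemma amu_le X X1 Y : X \in L -> X1 \in L -> Y \in L -> X \subset X1 -> X1 \subset Y ->
  amu X1 Y <= amu X Y.
Proof.
move=> XL X1L + XX1; have [n] := ubnP #|Y|; elim: n Y => // n IHn Y Yn YL X1Y.
have XY := subset_trans XX1 X1Y.
have [YX|/subsetPn[e eY eX1]] := boolP (Y \subset X1).
  have -> : Y = X1 by apply/eqP; rewrite eqEsubset YX.
  by rewrite amu_xx // amu_ge1.
have eE := subsetP (flat_sub YL) _ eY.
have eX : e \notin X by apply: contra eX1; apply/subsetP.
rewrite (weisner X1L YL X1Y eY eX1) (weisner XL YL XY eY eX).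
rewrite [leRHS](bigID (fun H => X1 \subset H)) /= -[leLHS]addr0; apply: lerD.
  rewrite [leRHS](eq_bigl (fun H => (H \in co e Y) && (X1 \subset H))) => [|H]; last first.
    by case: (boolP (X1 \subset H)) => X1H; rewrite ?andbF // (subset_trans XX1 X1H) ?andbT.
  apply: ler_sum => H /andP[/(coP eE)[HL _ HY _] X1H]; apply: IHn => //.
  exact: leq_trans (proper_card HY) _.
by apply: sumr_ge0 => H /andP[/andP[/(coP eE)[HL _ _ _] XH] _]; apply: amu_ge0.
Qed.

(** The part of rank [i] of the square of [amu] in the incidence algebra, for
    the intervals that start at the bottom. For a Boolean lattice it counts the
    subsets of size [i], which explains the bounds below. *)
Definition rank_conv i Y : rat :=
  \sum_(X in between (bot L) Y | rk L X == i) amu (bot L) X * amu X Y.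

(** The flats avoiding [e] contribute to [rank_conv] as the flats [H] of
    Weisner's theorem do altogether. *)
Lemma rank_conv_co i Y e : Y \in L -> e \in Y -> e \notin bot L ->
  \sum_(X in between (bot L) Y | (rk L X == i) && (e \notin X))
     amu (bot L) X * amu X Y = \sum_(H in co e Y) rank_conv i H.
Proof.
move=> YL eY eB; have eE := subsetP (flat_sub YL) _ eY.
rewrite (eq_bigr (fun X => \sum_(H in co e Y | X \subset H) amu (bot L) X * amu X H)); last first.
  move=> X /andP[]; rewrite betweenE => /and3P[XL _ XY] /andP[_ eX].
  by rewrite (weisner XL YL XY eY eX) mulr_sumr.
rewrite (exchange_big_dep (mem (co e Y))) /=; last by move=> X H _ /andP[].
apply: eq_bigr => H HY; apply: eq_bigl => X; rewrite !betweenE HY /=.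
have [HL eH /proper_sub HsY _] := coP eE HY.
case: (boolP (X \subset H)) => XH; rewrite ?andbF ?andbT //=.
by rewrite (subset_trans XH HsY) andbT (contra _ eH) ?andbT //; apply/subsetP.
Qed.

(** The flats avoiding [e] alone suffice, by induction. *)
Lemma rank_conv_ge i Y : Y \in L -> (i <= rk L Y)%N -> amu (bot L) Y <= rank_conv i Y.
Proof.
have [n] := ubnP #|Y|; elim: n Y => // n IHn Y Yn YL.
have term_ge0 X : X \in between (bot L) Y -> 0 <= amu (bot L) X * amu X Y.
  rewrite betweenE => /and3P[XL BX XY].
  by rewrite mulr_ge0 ?amu_ge0 ?bot_flat.
rewrite leq_eqVlt => /predU1P[->|iY].
  rewrite /rank_conv (bigD1 Y) ?betweenE ?YL ?bot_sub ?subxx ?eqxx //= amu_xx // mulr1.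
  by rewrite lerDl sumr_ge0 // => X /andP[/andP[XY _] _]; apply: term_ge0.
have /subsetPn[e eY eB] : ~~ (Y \subset bot L).
  by apply/negP => /rk_le; rewrite bot_flat YL rk_bot leqNgt (leq_trans _ iY) // => /(_ isT isT).
have eE := subsetP (flat_sub YL) _ eY.
rewrite (weisner bot_flat YL (bot_sub YL) eY eB).
apply: le_trans (_ : \sum_(H in co e Y) rank_conv i H <= _).
  rewrite (eq_bigl (mem (co e Y))) => [|H]; last exact: co_bot.
  apply: ler_sum => H /(coP eE)[HL _ HY rY]; apply: IHn => //.
    exact: leq_trans (proper_card HY) _.
  by rewrite -ltnS -rY.
rewrite -rank_conv_co // /rank_conv [leRHS](bigID (fun X : {set T} => e \notin X)) /=.
rewrite (eq_bigl (fun X => (X \in between (bot L) Y) && (rk L X == i) && (e \notin X))).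
  by rewrite lerDl sumr_ge0 // => X /andP[/andP[XY _] _]; apply: term_ge0.
by move=> X; rewrite andbA.
Qed.

(** The Pascal recursion: the flats avoiding [e] give the binomial for (m, i),
    and those containing [e] the one for (m, i - 1) because each of them is the
    join with [e] of flats of rank one less, over which Weisner's theorem
    spreads it. *)
Lemma rank_conv_le i Y : Y \in L -> rank_conv i Y <= 'C(rk L Y, i)%:R * amu (bot L) Y.
Proof.
have [n] := ubnP #|Y|; elim: n Y i => // n IHn Y i Yn YL.
have [YB|/subsetPn[e eY eB]] := boolP (Y \subset bot L).
  have -> : Y = bot L by apply/eqP; rewrite eqEsubset YB bot_sub.
  rewrite /rank_conv between_xx ?bot_flat // big_mkcondr big_set1 rk_bot bin0n eq_sym.
  by case: (i == 0%N); rewrite ?mul0r // !amu_xx ?bot_flat // mul1r.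
have eE := subsetP (flat_sub YL) _ eY.
have [m rY] : exists m, rk L Y = m.+1.
  have [H HY _] := co_above bot_flat YL (bot_sub YL) eY eB.
  by have [_ _ _ ->] := coP eE HY; exists (rk L H).
(* The flats that avoid e, in any rank j. *)
have part1 j : \sum_(X in between (bot L) Y | (rk L X == j) && (e \notin X))
     amu (bot L) X * amu X Y <= 'C(m, j)%:R * amu (bot L) Y.
  rewrite rank_conv_co // (weisner bot_flat YL (bot_sub YL) eY eB) mulr_sumr.
  rewrite [leRHS](eq_bigl (mem (co e Y))) => [|H]; last exact: co_bot.
  apply: ler_sum => H /(coP eE)[HL _ HY]; rewrite rY => -[->]; apply: IHn => //.
  exact: leq_trans (proper_card HY) _.
rewrite /rank_conv (bigID (fun X : {set T} => e \notin X)) /=.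
under eq_bigl do rewrite -andbA.
under [in X in _ + X]eq_bigl do rewrite -andbA.
case: i => [|i].
  rewrite [X in _ + X]big1 ?addr0; last first.
    move=> X /and3P[]; rewrite betweenE => /and3P[XL BX _] /eqP rX; rewrite negbK => eX.
    by move: eX eB; rewrite -(rk_inj bot_flat XL BX) ?rk_bot // => ->.
  by apply: le_trans (part1 0%N) _; rewrite !bin0.
rewrite rY binS natrD mulrDl; apply: lerD; first exact: part1.
apply: le_trans (part1 i).
rewrite (eq_bigr (fun X => \sum_(Z in co e X) amu (bot L) Z * amu X Y)); last first.
  move=> X /and3P[]; rewrite betweenE => /and3P[XL BX XY] _; rewrite negbK => eX.
  rewrite (weisner bot_flat XL BX eX eB) mulr_suml; apply: eq_bigl => H.
  exact: co_bot.
rewrite (exchange_big_dep (fun Z => (Z \in between (bot L) Y) && ((rk L Z == i) && (e \notin Z))))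
  /=; last first.
  move=> X Z /and3P[]; rewrite betweenE => /and3P[XL BX XY] /eqP rX _ /(coP eE)[ZL eZ ZX].
  by rewrite rX => -[->]; rewrite betweenE ZL bot_sub // (subset_trans (proper_sub ZX) XY) eZ eqxx.
apply: ler_sum => Z /and3P[]; rewrite betweenE => /and3P[ZL BZ ZY] /eqP rZ eZ.
rewrite (big_pred1 (jn Z e)) => [|X].
  apply: ler_wpM2l; first by rewrite amu_ge0 ?bot_flat.
  by apply: amu_le; rewrite ?jn_flat ?sub_jn ?jn_min.
rewrite /= [_ \in co _ _]inE ZL eZ /=; case: (eqVneq (jn Z e) X) => [<-|]; last by rewrite andbF.
by rewrite betweenE jn_flat // bot_sub ?jn_flat // jn_min // rk_jn // rZ eqxx mem_jn.
Qed.

(** * The Poincare polynomial at one *)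

(** The value at 1 of the Poincare polynomial of the minor ([poincare_minor]),
    which for an oriented matroid is the number of topes. *)
Definition topes X Y : rat := \sum_(Z in between X Y) amu X Z.

Lemma topes_xx X : X \in L -> topes X X = 1.
Proof. by move=> XL; rewrite /topes between_xx // big_set1 amu_xx. Qed.

Lemma topes_ge1 X Y : X \in L -> Y \in L -> X \subset Y -> 1 <= topes X Y.
Proof.
move=> XL YL XY; rewrite /topes (bigD1 X) ?betweenE ?XL ?subxx ?XY //= amu_xx // lerDl.
apply: sumr_ge0 => Z /andP[]; rewrite betweenE => /and3P[ZL XZ _] _.
exact: amu_ge0.
Qed.

(** The signed sum vanishes, so the flats of either parity carry half of the
    total. *)
Lemma topes_parity b X Y : X \in L -> Y \in L -> X \proper Y ->
  topes X Y = 2 * \sum_(Z in between X Y | odd (rk L Z) == b) amu X Z.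
Proof.
move=> XL YL XY; rewrite /topes (bigID (fun Z => odd (rk L Z) == b)) /=.
rewrite mulr_natl mulr2n; congr (_ + _); apply/eqP; rewrite eq_sym -subr_eq0.
have /eqP := mu_sum XL YL XY.
rewrite (bigID (fun Z => odd (rk L Z) == b)) /=.
set s : rat := (-1) ^+ (rk L X + b).
rewrite (eq_bigr (fun Z => s * amu X Z)) => [|Z /andP[_ /eqP oZ]]; last first.
  by rewrite amuE /s -oZ -signr_odd oddD -[in RHS]signr_odd oddD oddb.
rewrite [X in _ + X](eq_bigr (fun Z => - (s * amu X Z))) => [|Z /andP[_ oZ]]; last first.
  rewrite amuE /s -mulNr; congr (_ * _); rewrite -signr_odd -[in RHS]signr_odd !oddD oddb.
  by move: oZ; case: (odd (rk L Z)); case: (odd (rk L X)); case: b {s}; rewrite ?opprK.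
rewrite sumrN -!mulr_sumr -mulrBr mulf_eq0 => /orP[|//].
by rewrite signr_eq0.
Qed.

(** Add [rank_conv_le] over all ranks, with [amu X Y >= 1]. *)
Lemma topes_bot_le Y : Y \in L -> topes (bot L) Y <= 2 ^+ rk L Y * amu (bot L) Y.
Proof.
move=> YL.
have BI X : X \in between (bot L) Y -> [/\ X \in L, bot L \subset X & X \subset Y].
  by rewrite betweenE => /and3P[].
apply: le_trans (_ : \sum_(X in between (bot L) Y) amu (bot L) X * amu X Y <= _).
  apply: ler_sum => X /BI[XL BX XY].
  by rewrite ler_peMr ?amu_ge0 ?bot_flat ?amu_ge1.
rewrite (partition_big (fun X => inord (rk L X) : 'I_(rk L Y).+1) predT) //=.
have -> : 2 ^+ rk L Y = \sum_(i < (rk L Y).+1) 'C(rk L Y, i)%:R :> rat.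
  rewrite -[2 in LHS]/(1 + 1) exprDn; apply: eq_bigr => i _.
  by rewrite !expr1n mulr1.
rewrite mulr_suml; apply: ler_sum => i _.
apply: le_trans (rank_conv_le i YL); rewrite le_eqVlt; apply/orP; left; apply/eqP.
rewrite /rank_conv; apply: eq_bigl => X.
case: (boolP (X \in between (bot L) Y)) => //= /BI[XL BX XY].
by rewrite -val_eqE /= inordK // ltnS rk_le.
Qed.

(** For an oriented matroid this is the Euler relation of the boundary spheres
    of the topes, averaged. It holds in the incidence algebra: [topes] is the
    product of the Moebius function twisted by the sign of the rank and of the
    zeta function, and the same product with both factors twisted is its
    inverse. *)
Lemma topes_euler X Y : X \in L -> Y \in L -> X \proper Y ->
  \sum_(Z in between X Y) (-1) ^+ rk L Z * (topes X Z * topes Z Y) = 0.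
Proof.
move=> XL YL XY.
transitivity (\sum_(Z in between X Y) \sum_(A in between X Z) \sum_(B in between Z Y)
   (-1) ^+ (rk L X + rk L A + rk L B) * (mu X A * mu Z B)).
  apply: eq_bigr => Z ZI; rewrite /topes mulr_suml mulr_sumr; apply: eq_bigr => A AI.
  rewrite !mulr_sumr; apply: eq_bigr => B BI; rewrite /amu !exprD.
  have := @sqrr_sign rat (rk L Z); rewrite expr2.
  set u := (-1) ^+ _; set v := (-1) ^+ _; set w := (-1) ^+ _; set z := (-1) ^+ _.
  by move=> zz; rewrite -[RHS]mul1r -zz; ring.
transitivity (\sum_(A in between X Y) \sum_(B in between A Y) \sum_(Z in between A B)
   (-1) ^+ (rk L X + rk L A + rk L B) * (mu X A * mu Z B)).
  rewrite (exchange_big_dep (mem (between X Y))) /=; last first.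
    move=> Z A; rewrite !betweenE => /and3P[_ _ ZY] /and3P[-> -> AZ].
    exact: subset_trans AZ ZY.
  apply: eq_bigr => A; rewrite betweenE => /and3P[AL XA AY].
  rewrite (exchange_big_dep (mem (between A Y))) /=; last first.
    move=> Z B /andP[]; rewrite !betweenE => _ /and3P[_ _ AZ] /and3P[-> ZB ->].
    by rewrite (subset_trans AZ ZB).
  apply: eq_bigr => B; rewrite betweenE => /and3P[BL AB BY].
  apply: eq_bigl => Z; rewrite !betweenE BL BY XA AL /= andbT.
  apply/andP/and3P => [[/andP[/and3P[-> _ _] ->] ->]//|[ZL AZ ZB]].
  by rewrite ZL AZ ZB (subset_trans XA AZ) (subset_trans ZB BY).
rewrite (eq_bigr (fun A => (-1) ^+ rk L X * mu X A)) => [|A]; last first.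
  rewrite betweenE => /and3P[AL XA AY].
  rewrite (eq_bigr (fun B => (-1) ^+ (rk L X + rk L A + rk L B) * mu X A * (A == B)%:R)).
    rewrite (bigD1 A) ?betweenE ?AL ?subxx ?AY //= eqxx mulr1 big1 ?addr0.
      by rewrite -addnA addnn -mul2n exprD exprM sqrrN !expr1n mulr1.
    by move=> B /andP[_ /negPf]; rewrite eq_sym => ->; rewrite mulr0.
  move=> B; rewrite betweenE => /and3P[BL AB BY].
  by rewrite -mu_dual // mulr_sumr; apply: eq_bigr => Z _; rewrite mulrA.
by rewrite -mulr_sumr mu_sum // mulr0.
Qed.

(** * Numbers of faces *)

Local Notation r := (rk L E).

(** For an oriented matroid, [topes bot X * topes X E] counts the pairs formed by
    a face with zero set [X] and a tope above it. *)
Definition face_sum i : rat := \sum_(X in L | rk L X == i) topes (bot L) X * topes X E.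

Lemma between_botE Y X : (X \in between (bot L) Y) = (X \in L) && (X \subset Y).
Proof. by rewrite betweenE; case: (boolP (X \in L)) => //= /bot_sub->. Qed.

Lemma rk_le_top X : X \in L -> (rk L X <= r)%N.
Proof. by move=> XL; rewrite rk_le ?ground_flat ?flat_sub. Qed.

Lemma proper_top X : X \in L -> (rk L X < r)%N -> X \proper E.
Proof.
move=> XL rX; rewrite properEneq flat_sub // andbT.
by apply: contraTneq rX => ->; rewrite ltnn.
Qed.

(** The parity rule applied at the top. With the parity of [r - 1] it confines
    the sum to flats of rank less than [r]. *)
Lemma sum_topes_top b (P : pred {set T}) (f : {set T} -> rat) :
  (forall X, X \in L -> P X -> (rk L X < r)%N) ->
  \sum_(X in L | P X) f X * topes X E =
  2 * \sum_(Y in L | odd (rk L Y) == b)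
        \sum_(X in between (bot L) Y | P X) f X * amu X Y.
Proof.
move=> Pr; rewrite (exchange_big_dep (fun X => (X \in L) && P X)) /=; last first.
  by move=> Y X _ /andP[]; rewrite between_botE => /andP[-> _] ->.
rewrite mulr_sumr; apply: eq_bigr => X /andP[XL PX].
rewrite (@topes_parity b) ?ground_flat ?proper_top ?Pr // mulrCA !mulr_sumr.
apply: eq_big => [Y|Y _ //].
rewrite betweenE between_botE XL PX /= andbT; case: (boolP (Y \in L)) => //= YL.
by rewrite flat_sub // andbT andbC.
Qed.

(** The parity rule leaves flats of rank at most [r - 1], where [rank_conv_le]
    gives the binomials. The bound is the number of faces of codimension [i] of
    a cube of dimension [r - 1], which the topes of an oriented matroid do not
    reach on the average. *)
Lemma face_sum_lt i : (2 < r)%N -> (0 < i < r)%N ->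
  face_sum i < 2 ^+ i * 'C(r.-1, i)%:R * topes (bot L) E.
Proof.
move=> r3 /andP[i0 ir].
pose b := odd r.-1.
apply: (@le_lt_trans _ _ (2 ^+ i * \sum_(X in L | rk L X == i) amu (bot L) X * topes X E)).
  rewrite mulr_sumr; apply: ler_sum => X /andP[XL /eqP rX].
  rewrite mulrA ler_wpM2r //; last by rewrite -rX topes_bot_le.
  by apply: le_trans (topes_ge1 _ _ _); rewrite ?ground_flat ?flat_sub.
rewrite -mulrA ltr_pM2l ?exprn_gt0 //.
rewrite (sum_topes_top b) => [|X _ /eqP-> //].
have Bp : bot L \proper E by rewrite proper_top ?bot_flat // rk_bot; lia.
rewrite (@topes_parity b) ?bot_flat ?ground_flat // mulrCA ltr_pM2l //.
rewrite (eq_bigl (fun Y => (Y \in L) && (odd (rk L Y) == b))); last by move=> Y.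
rewrite [in ltRHS](eq_bigl (fun Y => (Y \in L) && (odd (rk L Y) == b))); last first.
  by move=> Y; rewrite between_botE; case: (boolP (Y \in L)) => //= YL; rewrite flat_sub.
rewrite mulr_sumr.
have amu0 Y : Y \in L -> 0 < amu (bot L) Y.
  by move=> YL; apply: lt_le_trans (amu_ge1 _ _ _); rewrite ?bot_flat ?bot_sub.
(* At rank r - 3, which has the right parity, the binomials differ. *)
have [Y0 + rY0] := @rk_between (bot L) E r.-1.-2 bot_flat ground_flat (proper_sub Bp)
  (ltac:(rewrite rk_bot; lia)).
rewrite between_botE => /andP[Y0L _].
have Y0b : (Y0 \in L) && (odd (rk L Y0) == b).
  rewrite Y0L rY0 /b; apply/eqP; lia.
rewrite [ltLHS](bigD1 Y0) // [ltRHS](bigD1 Y0) //=; apply: ltr_leD.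
  apply: le_lt_trans (rank_conv_le i Y0L) _; rewrite rY0 ltr_pM2r ?amu0 // ltr_nat.
  have [m [rm ->]] : exists m, r = m.+3 /\ r.-1.-2 = m by exists r.-1.-2; lia.
  rewrite rm /= ltnS in ir *; case: i i0 ir => // j _ jm.
  by rewrite 2!binS -addnA -[X in (X < _)%N]addn0 ltn_add2l addn_gt0 !bin_gt0; lia.
apply: ler_sum => Y /andP[/andP[YL /eqP bY] _].
apply: le_trans (rank_conv_le i YL) _; rewrite ler_pM2r ?amu0 // ler_nat.
by apply: leq_bin2l; apply: odd_pred_le bY; rewrite ?rk_le_top ?(ltn_trans i0).
Qed.

Lemma topes_coatom H : H \in L -> rk L H = r.-1 -> (0 < r)%N -> topes H E = 2.
Proof.
move=> HL rH r0; have HE : H \proper E by rewrite proper_top // rH prednK.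
rewrite (@topes_parity (odd (rk L H))) ?ground_flat // (big_pred1 H) ?amu_xx ?mulr1 // => Z.
rewrite betweenE /=; apply/andP/eqP => [[/and3P[ZL HZ ZE] /eqP oZ]|->]; last first.
  by rewrite HL subxx proper_sub.
apply/esym; apply: rk_inj => //; apply/eqP.
rewrite eqn_leq rk_le //= rH; apply: odd_pred_le; rewrite ?rk_le_top //.
by rewrite oZ rH.
Qed.

Lemma two_coatoms j : (j.+1 < r)%N -> exists Z H1 H2, [/\ Z \in L, rk L Z = j, H1 != H2,
  (H1 \in between Z E) && (rk L H1 == r.-1) & (H2 \in between Z E) && (rk L H2 == r.-1)].
Proof.
move=> jr; have r_pos : (r.-1 < r)%N by rewrite prednK ?leqnn ?(ltn_trans _ jr).
have jr' : (j < r.-1)%N by rewrite -ltnS (ltn_predK jr).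
have [|Z + rZ] := @rk_between (bot L) E j bot_flat ground_flat (bot_sub ground_flat).
  by rewrite rk_bot (ltnW (ltnW jr)).
rewrite between_botE => /andP[ZL ZE].
have [|H1 H1I r1E] := @rk_between Z E r.-1 ZL ground_flat ZE.
  by rewrite rZ (ltnW jr') leq_pred.
have := H1I; rewrite betweenE => /and3P[H1L ZH1 H1E].
have /properP[_ [f fE fH1]] : H1 \proper E by rewrite proper_top // r1E.
have fZ : f \notin Z by apply: contra fH1; apply/subsetP.
have JL := jn_flat ZL fE; have JE := jn_min ground_flat ZE fE.
have [|H2 + r2E] := @rk_between (jn Z f) E r.-1 JL ground_flat JE.
  by rewrite rk_jn // rZ jr' leq_pred.
rewrite betweenE => /and3P[H2L JH2 H2E].
exists Z, H1, H2; split => //; rewrite ?H1I ?r1E ?r2E ?eqxx //.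
  by apply: contraNneq fH1 => ->; apply: (subsetP JH2); apply: mem_jn.
by rewrite betweenE H2L H2E (subset_trans (sub_jn _ _) JH2).
Qed.

(** Every flat of the parity of [r - 1] lies in a hyperplane, and one of rank
    [r - 3] lies in at least two. *)
Lemma face_sum_coatoms_gt : (2 < r)%N -> 2 * topes (bot L) E < face_sum r.-1.
Proof.
move=> r3; pose b := odd r.-1; have r0 : (0 < r)%N by apply: ltn_trans r3.
have Bp : bot L \proper E by rewrite proper_top ?bot_flat // rk_bot.
have -> : face_sum r.-1 = 4 * \sum_(H in L | rk L H == r.-1)
    \sum_(Z in between (bot L) H | odd (rk L Z) == b) amu (bot L) Z.
  rewrite mulr_sumr; apply: eq_bigr => H /andP[HL /eqP rH].
  rewrite topes_coatom // (@topes_parity b) ?bot_flat //; first by ring.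
  rewrite properEneq bot_sub // andbT; apply: contraTneq r3 => BH.
  by move: rH; rewrite -BH rk_bot; case: (rk L E) r0 => [|[|]].
rewrite (@topes_parity b) ?bot_flat ?ground_flat // mulrA -natrM ltr_pM2l //.
have oddE Z : Z \in L -> odd (rk L Z) == b -> (rk L Z <= r.-1)%N.
  by move=> ZL /eqP; apply: odd_pred_le; rewrite ?rk_le_top.
rewrite [ltRHS](exchange_big_dep (fun Z => (Z \in between (bot L) E) && (odd (rk L Z) == b)))
  /=; last first.
  move=> H Z /andP[HL _] /andP[]; rewrite !between_botE => /andP[ZL ZH] ->.
  by rewrite ZL flat_sub.
have [|Z0 [H1 [H2 [Z0L rZ0 H12 P1 P2]]]] := @two_coatoms r.-1.-2.
  by case: (rk L E) r3 => [|[|[|]]] //= n _; rewrite ltnS leqnSn.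
have amu0 Z : Z \in L -> 0 < amu (bot L) Z.
  by move=> ZL; apply: lt_le_trans (amu_ge1 _ _ _); rewrite ?bot_flat ?bot_sub.
have Z0P : (Z0 \in between (bot L) E) && (odd (rk L Z0) == b).
  rewrite between_botE Z0L flat_sub //= rZ0 /b; case: (rk L E) r3 => [|[|[|]]] //= n _.
  by rewrite negbK.
have inner Z H : (Z \in between (bot L) E) && (odd (rk L Z) == b) ->
    (H \in between Z E) && (rk L H == r.-1) ->
    (H \in L) && (rk L H == r.-1) && ((Z \in between (bot L) H) && (odd (rk L Z) == b)).
  move=> /andP[ZB ->] /andP[]; rewrite betweenE => /and3P[-> ZH _] ->.
  by move: ZB; rewrite !between_botE ZH => /andP[-> _].
rewrite (bigD1 Z0) // [ltRHS](bigD1 Z0) //=; apply: ltr_leD.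
  rewrite (bigD1 H1) ?inner //= (bigD1 H2) ?inner // 1?eq_sym ?H12 //=.
  rewrite ltrDl ltr_wpDr ?amu0 //.
  by apply: sumr_ge0 => H _; apply/ltW/amu0.
apply: ler_sum => Z /andP[ZP _]; have := ZP; rewrite between_botE => /andP[/andP[ZL ZE] oZ].
have [|H HI rH] := @rk_between Z E r.-1 ZL ground_flat ZE.
  by rewrite oddE // leq_pred.
rewrite (bigD1 H) ?inner ?HI ?rH ?eqxx //= lerDl.
by apply: sumr_ge0 => H' _; apply/ltW/amu0.
Qed.

(** The parity of [r - 1] is odd, hence it excludes the bottom, where
    [rank_conv_ge] fails for [i = 1]. *)
Lemma face_sum1_ge : ~~ odd r -> (0 < r)%N -> 2 * topes (bot L) E <= face_sum 1.
Proof.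
move=> r_even r0.
have Bp : bot L \proper E by rewrite proper_top ?bot_flat // rk_bot.
have r1 : (1 < r)%N by case: (rk L E) r0 r_even => [|[|]].
have -> : face_sum 1 = 2 * \sum_(X in L | rk L X == 1%N) amu (bot L) X * topes X E.
  rewrite mulr_sumr; apply: eq_bigr => X /andP[XL /eqP rX].
  have BX : bot L \proper X.
    by rewrite properEneq bot_sub // andbT; apply: contra_eq_neq rX => <-; rewrite rk_bot.
  have BXE Z : Z \in between (bot L) X -> odd (rk L Z) = true -> Z = X.
    rewrite between_botE => /andP[ZL ZX] oZ; apply: rk_inj => //; rewrite rX.
    by have := rk_le ZL XL ZX; rewrite rX; case: (rk L Z) oZ => [|[|]].
  rewrite (@topes_parity true) ?bot_flat // (big_pred1 X) ?mulrA // => Z /=.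
  apply/andP/eqP => [[ZI /eqP]|->]; first exact: BXE.
  by rewrite between_botE XL subxx rX.
rewrite (sum_topes_top true) => [|X _ /eqP-> //].
rewrite (@topes_parity true) ?bot_flat ?ground_flat // ler_pM2l // ler_pM2l //.
rewrite [leLHS](eq_bigl (fun Y => (Y \in L) && (odd (rk L Y) == true))); last first.
  by move=> Y; rewrite between_botE; case: (boolP (Y \in L)) => //= YL; rewrite flat_sub.
apply: ler_sum => Y /andP[YL /eqP oY]; apply: rank_conv_ge => //.
by case: (rk L Y) oY.
Qed.

(** * Euler relations and flags in ranks three and four *)

(** Unlike [face_sum], over any interval: the relations are applied to
    intervals at both ends of a flag. *)
Definition conv i X Y : rat :=
  \sum_(Z in between X Y | rk L Z == (rk L X + i)%N) topes X Z * topes Z Y.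

Lemma conv_bot i : face_sum i = conv i (bot L) E.
Proof.
apply: eq_bigl => X; rewrite between_botE rk_bot add0n.
by case: (boolP (X \in L)) => //= XL; rewrite flat_sub.
Qed.

Lemma between_rk_sum X Y (f : {set T} -> rat) : X \in L -> Y \in L -> X \subset Y ->
  \sum_(Z in between X Y) f Z =
  \sum_(i < (rk L Y - rk L X).+1) \sum_(Z in between X Y | rk L Z == (rk L X + i)%N) f Z.
Proof.
move=> XL YL XY.
rewrite (partition_big (fun Z => inord (rk L Z - rk L X) : 'I_(rk L Y - rk L X).+1) predT) //=.
apply: eq_bigr => i _; apply: eq_bigl => Z.
case: (boolP (Z \in between X Y)) => //=; rewrite betweenE => /and3P[ZL XZ ZY].
rewrite -val_eqE /= inordK ?ltnS ?leq_sub2r ?rk_le //.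
by have rXZ := rk_le XL ZL XZ; apply/eqP/eqP => [<-|->]; rewrite ?subnKC ?addKn.
Qed.

Lemma conv0 X Y : X \in L -> Y \in L -> X \subset Y -> conv 0 X Y = topes X Y.
Proof.
move=> XL YL XY; rewrite /conv (big_pred1 X) ?topes_xx ?mul1r // => Z; rewrite addn0.
rewrite /= betweenE; apply/andP/eqP => [[/and3P[ZL XZ _] /eqP rZ]|->].
  by apply/esym/rk_inj.
by rewrite XL subxx XY.
Qed.

Lemma conv_top X Y : X \in L -> Y \in L -> X \subset Y ->
  conv (rk L Y - rk L X) X Y = topes X Y.
Proof.
move=> XL YL XY; rewrite /conv (big_pred1 Y) ?topes_xx ?mulr1 // => Z.
rewrite subnKC ?rk_le //= betweenE; apply/andP/eqP => [[/and3P[ZL _ ZY] /eqP rZ]|->].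
  exact: rk_inj.
by rewrite YL subxx XY.
Qed.

Lemma conv_euler X Y : X \in L -> Y \in L -> X \proper Y ->
  \sum_(i < (rk L Y - rk L X).+1) (-1) ^+ i * conv i X Y = 0.
Proof.
move=> XL YL XY; have := topes_euler XL YL XY.
rewrite between_rk_sum ?proper_sub // => /(congr1 (fun u => (-1) ^+ rk L X * u)).
rewrite mulr0 mulr_sumr => euler; rewrite -[RHS]euler; apply: eq_bigr => i _.
rewrite /conv !mulr_sumr; apply: eq_bigr => Z /andP[_ /eqP->].
by rewrite mulrA -exprD addnA addnn -mul2n exprD exprM sqrrN !expr1n mul1r.
Qed.

Lemma proper_rk X Y : X \subset Y -> (rk L X < rk L Y)%N -> X \proper Y.
Proof. by move=> XY rXY; rewrite properEneq XY andbT; apply: contraTneq rXY => ->; rewrite ltnn. Qed.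

Lemma conv2 X Y : X \in L -> Y \in L -> X \subset Y -> rk L Y = (rk L X + 2)%N ->
  conv 1 X Y = 2 * topes X Y.
Proof.
move=> XL YL XY rY; have XpY : X \proper Y.
  by rewrite proper_rk // rY -[Z in (Z < _)%N]addn0 ltn_add2l.
have := conv_euler XL YL XpY; have := conv_top XL YL XY; rewrite rY addKn.
rewrite !big_ord_recl big_ord0 /bump /= conv0 // => ->.
by rewrite !exprS expr0; lra.
Qed.

Lemma conv3 X Y : X \in L -> Y \in L -> X \subset Y -> rk L Y = (rk L X + 3)%N ->
  conv 1 X Y = conv 2 X Y.
Proof.
move=> XL YL XY rY; have XpY : X \proper Y.
  by rewrite proper_rk // rY -[Z in (Z < _)%N]addn0 ltn_add2l.
have := conv_euler XL YL XpY; have := conv_top XL YL XY; rewrite rY addKn.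
rewrite !big_ord_recl big_ord0 /bump /= conv0 // => ->.
by rewrite !exprS expr0; lra.
Qed.

Lemma conv4 X Y : X \in L -> Y \in L -> X \subset Y -> rk L Y = (rk L X + 4)%N ->
  conv 1 X Y + conv 3 X Y = conv 2 X Y + 2 * topes X Y.
Proof.
move=> XL YL XY rY; have XpY : X \proper Y.
  by rewrite proper_rk // rY -[Z in (Z < _)%N]addn0 ltn_add2l.
have := conv_euler XL YL XpY; have := conv_top XL YL XY; rewrite rY addKn.
rewrite !big_ord_recl big_ord0 /bump /= conv0 // => ->.
by rewrite !exprS expr0; lra.
Qed.

(** Up to division by [topes bot E], the average number of flags of [k] proper
    faces in the boundary of a tope. *)
Definition flag_sum k Y : rat := chain_sum topes (L :\: [set bot L; E]) (bot L) k Y.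

Lemma flag_sum0 Y : flag_sum 0 Y = topes (bot L) Y.
Proof. by []. Qed.

Lemma flag_sumS k Y : Y \in L ->
  flag_sum k.+1 Y = \sum_(i < (rk L Y).-1)
     \sum_(X in between (bot L) Y | rk L X == i.+1) flag_sum k X * topes X Y.
Proof.
move=> YL; rewrite /flag_sum /=.
rewrite (eq_bigl (fun X => (X \in between (bot L) Y) && (0 < rk L X < rk L Y)%N)).
  rewrite (partition_big (fun X => inord (rk L X).-1 : 'I_(rk L Y).-1.+1) predT) //=.
  rewrite big_ord_recr /= [X in _ + X]big1 ?addr0.
    apply: eq_bigr => i _; apply: eq_bigl => X; rewrite -andbA; congr (_ && _).
    have iY := ltn_ord i; rewrite -val_eqE /=.
    apply/andP/eqP => [[/andP[X0 XY] /eqP<-]|rX].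
      by rewrite inordK ?prednK //; lia.
    by rewrite rX /= -ltn_predRL iY inordK // ltnS ltnW.
  move=> X /andP[/andP[_ /andP[X0 XY]]]; rewrite -val_eqE /= inordK; lia.
move=> X; rewrite !inE negb_or; case: (boolP (X \in L)) => XL; last by rewrite andbF.
rewrite bot_sub //= andbT; apply/andP/andP => [[/andP[X0 XE] XY]|[XY /andP[X0 rXY]]].
  rewrite proper_sub //; split=> //; rewrite rk_lt // andbT lt0n.
  by apply: contra X0 => /eqP rX; apply/eqP/esym/rk_inj; rewrite ?bot_flat ?bot_sub ?rk_bot.
have neqr A B : (rk L A < rk L B)%N -> A != B by apply: contraTneq => ->; rewrite ltnn.
split; last by rewrite properEneq XY neqr.
by rewrite (neqr X E) ?(leq_trans rXY) ?rk_le_top // andbT eq_sym neqr ?rk_bot.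
Qed.

Lemma flag_sum1 Y : Y \in L ->
  flag_sum 1 Y = \sum_(i < (rk L Y).-1) conv i.+1 (bot L) Y.
Proof.
move=> YL; rewrite flag_sumS //; apply: eq_bigr => i _.
by apply: eq_bigl => X; rewrite rk_bot.
Qed.

(** The next lemmas average known f-vectors over the topes. Two points bound a
    segment; the subdivided boundary of an n-gon has f-vector (1, 2n, 2n); that
    of a polyhedron with e edges has f-vector (1, 2e + 2, 6e, 4e). *)
Lemma flag_sum_rk2 Y : Y \in L -> rk L Y = 2%N -> flag_sum 1 Y = 2 * topes (bot L) Y.
Proof.
move=> YL rY; rewrite flag_sum1 // rY big_ord1.
by rewrite conv2 ?bot_flat ?bot_sub // rk_bot rY.
Qed.

Lemma flag_sum_rk3 Y : Y \in L -> rk L Y = 3%N ->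
  flag_sum 1 Y = 2 * conv 2 (bot L) Y /\ flag_sum 2 Y = 2 * conv 2 (bot L) Y.
Proof.
move=> YL rY; split.
  rewrite flag_sum1 // rY !big_ord_recl big_ord0 /=.
  by rewrite conv3 ?bot_flat ?bot_sub ?rk_bot ?rY // addr0 mulr_natl.
rewrite flag_sumS // rY !big_ord_recl big_ord0 /= addr0.
rewrite big1 ?add0r => [|X /andP[]]; last first.
  rewrite between_botE => /andP[XL _] /eqP rX.
  by rewrite flag_sum1 // rX big_ord0 mul0r.
rewrite /conv rk_bot mulr_sumr; apply: eq_bigr => X /andP[].
rewrite between_botE => /andP[XL _] /eqP rX.
by rewrite flag_sum_rk2 // mulrA.
Qed.

Lemma flag_sum_rk4 : r = 4%N ->
  [/\ flag_sum 1 E = 2 * conv 2 (bot L) E + 2 * topes (bot L) E,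
       flag_sum 2 E = 6 * conv 2 (bot L) E & flag_sum 3 E = 4 * conv 2 (bot L) E].
Proof.
move=> rE; have EL := ground_flat.
(* Incident pairs of an edge and a vertex: each edge has two vertices. *)
have conv23 : \sum_(X in between (bot L) E | rk L X == 3%N) conv 2 (bot L) X * topes X E =
    2 * conv 2 (bot L) E.
  rewrite /conv rk_bot mulr_sumr.
  under eq_bigr do rewrite mulr_suml.
  rewrite (exchange_big_dep (fun Z => (Z \in between (bot L) E) && (rk L Z == 2%N))) /=; last first.
    move=> X Z /andP[]; rewrite !between_botE => /andP[XL XE] _ /andP[/andP[-> ZX] ->].
    by rewrite (subset_trans ZX XE).
  apply: eq_bigr => Z /andP[]; rewrite between_botE => /andP[ZL ZE] /eqP rZ.
  rewrite mulrCA -conv2 ?rE ?rZ // /conv mulr_sumr; apply: eq_big => [X|X _]; last by rewrite mulrA.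
  rewrite !between_botE betweenE rZ ZL eqxx andbT /= -!andbA.
  by case: (X \in L) => //=; case: (X \subset E); case: (Z \subset X); rewrite ?andbF ?andbT.
have r1 X : X \in L -> rk L X = 1%N -> forall k, flag_sum k.+1 X = 0.
  by move=> XL rX k; rewrite flag_sumS // rX big_ord0.
have r2 X : X \in L -> rk L X = 2%N -> flag_sum 2 X = 0.
  move=> XL rX; rewrite flag_sumS // rX big_ord1 big1 // => Z /andP[].
  by rewrite between_botE => /andP[ZL _] /eqP rZ; rewrite r1 ?mul0r.
split.
- rewrite flag_sum1 // rE !big_ord_recl big_ord0 /= addr0 /bump /=.
  by have := conv4 bot_flat EL (bot_sub EL); rewrite rk_bot rE => /(_ erefl); lra.
- rewrite flag_sumS // rE !big_ord_recl big_ord0 /= addr0 /bump /=.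
  rewrite big1 ?add0r => [|X /andP[]]; last first.
    by rewrite between_botE => /andP[XL _] /eqP rX; rewrite r1 ?mul0r.
  rewrite (eq_bigr (fun X => 2 * (topes (bot L) X * topes X E))) => [|X /andP[]]; last first.
    by rewrite between_botE => /andP[XL _] /eqP rX; rewrite flag_sum_rk2 ?mulrA.
  rewrite [X in _ + X](eq_bigr (fun X => 2 * (conv 2 (bot L) X * topes X E)))
    => [|X /andP[]]; last first.
    by rewrite between_botE => /andP[XL _] /eqP rX; rewrite (flag_sum_rk3 XL rX).1 mulrA.
  rewrite -!mulr_sumr conv23 /conv rk_bot; ring.
- rewrite flag_sumS // rE !big_ord_recl big_ord0 /= addr0 /bump /=.
  rewrite [Z in Z + _]big1 ?add0r => [|X /andP[]]; last first.
    by rewrite between_botE => /andP[XL _] /eqP rX; rewrite r1 ?mul0r.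
  rewrite [Z in Z + _]big1 ?add0r => [|X /andP[]]; last first.
    by rewrite between_botE => /andP[XL _] /eqP rX; rewrite r2 ?mul0r.
  rewrite (eq_bigr (fun X => 2 * (conv 2 (bot L) X * topes X E))) => [|X /andP[]]; last first.
    by rewrite between_botE => /andP[XL _] /eqP rX; rewrite (flag_sum_rk3 XL rX).2 mulrA.
  by rewrite -!mulr_sumr conv23; ring.
Qed.

End Flats.

(** * Poincare polynomials of minors *)

Section Minors.
Variables (T : finType) (E : {set T}) (L : {set {set T}}).
Hypothesis LP : is_flats E L.
Implicit Types (F G H X Y Z : {set T}).

Lemma minor_bot X Y : X \in L -> X \subset Y -> bot (minor_flats L X Y) = set0.
Proof.
move=> XL XY; apply/eqP; rewrite -subset0 -(setDv X); apply: (bigcap_inf (X :\: X)).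
by apply/imsetP; exists X; rewrite // inE XL subxx.
Qed.

Lemma setDKU (X Z : {set T}) : X \subset Z -> Z :\: X :|: X = Z.
Proof. by move=> XZ; rewrite setUC -{1}(setIidPr XZ) setID. Qed.

Lemma subsetDD (X A B : {set T}) : X \subset B -> (A :\: X \subset B :\: X) = (A \subset B).
Proof. by move=> XB; rewrite subDset setUC setDKU. Qed.

Lemma properDD (X A B : {set T}) : X \subset A -> X \subset B ->
  (A :\: X \proper B :\: X) = (A \proper B).
Proof. by move=> XA XB; rewrite !properE !subsetDD. Qed.

Lemma mobius_minor X Y Z : X \in L -> Y \in L -> Z \in between L X Y ->
  mobius (minor_flats L X Y) (Z :\: X) = mobius [set Z in L | X \subset Z] Z.
Proof.
move=> XL YL; have [n] := ubnP #|Z|; elim: n Z => // n IHn Z Zn.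
rewrite betweenE => /and3P[ZL XZ ZY]; have XY := subset_trans XZ ZY.
have [XeZ|ZnX] := eqVneq Z X.
  rewrite XeZ setDv; have := mobius_bot [set Z in L | X \subset Z].
  by rewrite up_bot // => ->; rewrite -[RHS](mobius_bot (minor_flats L X Y)) minor_bot.
rewrite !mobius_rec; last 2 first.
- by rewrite up_bot.
- rewrite minor_bot // setD_eq0; apply: contra ZnX => ZX.
  by rewrite eqEsubset ZX.
congr (- _); rewrite big_mkcondr big_imset /=; last first.
  move=> A B; rewrite !inE => /and3P[_ XA _] /and3P[_ XB _] AB.
  by rewrite -(setDKU XA) AB setDKU.
rewrite -big_mkcondr /=; apply: eq_big => [W|W].
  rewrite !inE; case: (boolP (W \in L)) => //= WL.
  case: (boolP (X \subset W)) => //= XW.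
  rewrite properDD //; case: (boolP (W \proper Z)) => [/proper_sub WZ|]; rewrite ?andbF //.
  by rewrite (subset_trans WZ ZY).
rewrite !inE => /andP[/and3P[WL XW WY]]; rewrite properDD // => WZ.
by rewrite IHn ?betweenE ?WL ?XW ?WY // (leq_trans (proper_card WZ)).
Qed.

(** Adding [X] back to a flat of the minor gives a flat of [L], and this
    preserves covers, so the shifted rank is graded on the minor. *)
Lemma rk_minor X Y Z : X \in L -> Y \in L -> Z \in between L X Y ->
  rk (minor_flats L X Y) (Z :\: X) = (rk L Z - rk L X)%N.
Proof.
move=> XL YL ZI; have := ZI; rewrite betweenE => /and3P[ZL XZ ZY].
have XY := subset_trans XZ ZY.
have inM W : W \in between L X Y -> W :\: X \in minor_flats L X Y.
  by move=> WI; apply/imsetP; exists W.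
have outM F : F \in minor_flats L X Y -> exists2 W, W \in between L X Y & F = W :\: X.
  by move=> /imsetP[W WI ->]; exists W.
rewrite (graded_rk (minor_flatsP LP XL YL XY) (rho := fun F => rk L (F :|: X) - rk L X)%N).
- by rewrite setDKU.
- move=> F G [/outM[A AI ->] /outM[B BI ->] + Mcov].
  move: (AI) (BI); rewrite !betweenE => /and3P[AL XA AY] /and3P[BL XB BY].
  rewrite properDD // !setDKU // => AB.
  rewrite (rk_covers LP (F := A)) ?subSn ?(rk_le LP) //; split => // H HL AH; apply/negP => HB.
  have XH := subset_trans XA (proper_sub AH).
  have HI : H \in between L X Y by rewrite betweenE HL XH (subset_trans (proper_sub HB) BY).
  by have := Mcov _ (inM _ HI); rewrite !properDD // => /(_ AH); rewrite HB.
- by rewrite minor_bot // set0U subnn.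
- exact: inM.
Qed.

Lemma poincare_minor X Y : X \in L -> Y \in L -> X \subset Y ->
  (poincare (minor_flats L X Y)).[1] = topes L X Y.
Proof.
move=> XL YL XY; rewrite /poincare horner_sum big_imset /=; last first.
  move=> A B; rewrite !inE => /and3P[_ XA _] /and3P[_ XB _] AB.
  by rewrite -(setDKU XA) AB setDKU.
apply: eq_bigr => Z ZI; have := ZI; rewrite inE => /and3P[ZL XZ ZY].
rewrite mobius_minor // rk_minor // hornerZ horner_exp hornerN hornerX.
rewrite mulrC /amu -[(-1) ^+ (rk L Z - _)]signr_odd oddB ?(rk_le LP) // addbC -oddD signr_odd.
by [].
Qed.

Lemma poincare1 : (poincare L).[1] = topes L (bot L) E.
Proof.
have upL : [set Z in L | bot L \subset Z] = L.
  by apply/setP => Z; rewrite inE; case: (boolP (Z \in L)) => //= /bot_sub ->.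
have LI : between L (bot L) E = L.
  by apply/setP => Z; rewrite betweenE; case: (boolP (Z \in L)) => //= ZL;
     rewrite bot_sub ?(flat_sub LP).
rewrite /poincare horner_sum /topes LI; apply: eq_bigr => Z ZL.
rewrite hornerZ horner_exp hornerN hornerX mulrC /amu /mu upL (rk_bot LP).
by [].
Qed.

End Minors.

(** * The coarse flag polynomial as an h-polynomial *)

(** The h-polynomial of a complex of dimension [d - 1] with face numbers [c]. *)
Definition h_of_f (d : nat) (c : nat -> rat) : {poly rat} :=
  \sum_(k < d.+1) c k *: ('X^k * (1 - 'X) ^+ (d - k)).

(** Dehn-Sommerville relations in dimensions one and two. *)
Lemma h_of_f2 c : c 0%N = 1 -> c 2%N = c 1%N ->
  h_of_f 2 c = 1 + (c 1%N - 2)%:P * 'X + 'X^2.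
Proof.
move=> c0 c2; rewrite /h_of_f !big_ord_recl big_ord0 /bump /= c0 c2 -!mul_polyC polyCB !polyC1.
by rewrite !subSS !subn0 !expr0 !expr1 polyC_natr; ring.
Qed.

Lemma h_of_f3 c : c 0%N = 1 -> c 2%N = 3 * c 1%N - 6 -> c 3%N = 2 * c 1%N - 4 ->
  h_of_f 3 c = 1 + (c 1%N - 3)%:P * ('X + 'X^2) + 'X^3.
Proof.
move=> c0 c2 c3; rewrite /h_of_f !big_ord_recl big_ord0 /bump /= c0 c2 c3 -!mul_polyC.
rewrite !polyCB !polyCM !polyC1 !polyC_natr.
by rewrite !subSS !subn0 !expr0 !expr1; ring.
Qed.

Lemma coef_h_of_f d c i : (h_of_f d c)`_i =
  \sum_(k < d.+1) c k * ('X^k * (1 - 'X) ^+ (d - k) : {poly rat})`_i.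
Proof. by rewrite coef_sum; apply: eq_bigr => k _; rewrite coefZ. Qed.

Lemma coef01_exp_1subX n :
  ((1 - 'X) ^+ n : {poly rat})`_0 = 1 /\ ((1 - 'X) ^+ n : {poly rat})`_1 = - n%:R.
Proof.
elim: n => [|n [IH0 IH1]]; first by rewrite expr0 !coef1 oppr0.
rewrite exprS mulrBl mul1r !coefB !coefXM /= IH0 IH1 subr0; split=> //.
by rewrite -opprD -[n.+1]addn1 natrD.
Qed.

Lemma coef1_h_of_f d c : (0 < d)%N -> (h_of_f d c)`_1 = c 1%N - d%:R * c 0%N.
Proof.
case: d => // d _; rewrite coef_h_of_f !big_ord_recl big1 ?addr0 => [|k _].
  rewrite /= /bump /= expr0 mul1r subn0 (coef01_exp_1subX d.+1).2.
  by rewrite expr1 coefXM /= (coef01_exp_1subX _).1; ring.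
by rewrite coefXnM /= mulr0.
Qed.

Section Matroid.
Variables (T : finType) (M : matroid T).
Local Notation L := (flats M).
Local Notation E := (ground M).
Local Notation r := (rank M).
Let LP := flatsP M.

Lemma chain_sum_poincare k Y : Y \in L ->
  chain_sum (fun X Z => (poincare (minor_flats L X Z)).[1]) (proper_flats M) (bot L) k Y =
  flag_sum E L k Y.
Proof.
elim: k Y => [|k IHk] Y YL /=.
  by rewrite (poincare_minor LP) ?(bot_flat LP) ?bot_sub.
rewrite /flag_sum /=; apply: eq_bigr => X /andP[XQ XY].
have XL : X \in L by move: XQ; rewrite inE => /andP[].
by rewrite (poincare_minor LP) ?proper_sub // IHk.
Qed.

(** Needed because the exponent [r.-1 - #|C|] of the coarse flag polynomial is
    a truncated subtraction. *)
Lemma order_complex_card (C : {set {set T}}) : (0 < r)%N ->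
  C \in order_complex (proper_flats M) -> (#|C| <= r.-1)%N.
Proof.
move=> r0 /order_complexP[CQ ch].
have CP X : X \in C -> [/\ X \in L, X != bot L, X != E, bot L \subset X & X \subset E].
  move=> /CQ; rewrite !inE negb_or => /andP[/andP[XB XE] XL].
  by split; rewrite ?bot_sub ?(flat_sub LP).
have EL := ground_flat LP; have BL := bot_flat LP.
pose D := bot L |: (E |: C).
have BE : bot L != E by apply: contraTneq r0 => BE; rewrite /rank -BE (rk_bot LP).
have cD : #|D| = #|C|.+2.
  rewrite !cardsU1 !inE negb_or BE /=.
  have -> : bot L \notin C by apply/negP => /CP[_ /eqP].
  by have -> : E \notin C by apply/negP => /CP[_ _ /eqP].
have DP X : X \in D -> X \in between L (bot L) E.
  by rewrite betweenE => /setU1P[->|/setU1P[->|/CP[-> _ _ -> ->]//]]; rewrite ?BL ?EL ?subxx ?bot_sub.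
suff : (#|D| <= r.+1)%N by rewrite cD; case: r r0.
have := graded_len LP (rk_covers LP) BL EL (bot_sub EL).
rewrite (rk_bot LP) addn0 /rank => <-; apply: len_ge; apply/order_complexP; split.
  exact: DP.
move=> X Y XD YD.
have := DP _ XD; have := DP _ YD; rewrite !betweenE => /and3P[_ BY YE] /and3P[_ BX XE].
case/setU1P: XD => [->|/setU1P[->|XC]]; [by rewrite BY | by rewrite YE orbT|].
by case/setU1P: YD => [->|/setU1P[->|YC]]; [rewrite BX orbT | rewrite XE | apply: ch].
Qed.

Definition flag_ratio k : rat := flag_sum E L k E / topes L (bot L) E.

Lemma normalized_coarse_flag_polyE : (0 < r)%N ->
  normalized_coarse_flag_poly M = h_of_f r.-1 flag_ratio.
Proof.
move=> r0; have EL := ground_flat LP.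
rewrite /normalized_coarse_flag_poly (poincare1 LP) /h_of_f rmorph_sum /= scaler_sumr.
rewrite (partition_big (fun C : {set {set T}} => inord #|C| : 'I_r.-1.+1) predT) //=.
apply: eq_bigr => k _.
rewrite /flag_ratio -chain_sum_poincare // mulrC -scalerA.
rewrite -sum_chain_weight scaler_suml scaler_sumr.
have -> : [set X in proper_flats M | X \proper E] = proper_flats M.
  apply/setP => X; rewrite !inE; case: (boolP (X \in L)) => XL; rewrite ?andbF //=.
  by rewrite properEneq (flat_sub LP XL) andbT negb_or andbT -andbA andbb.
apply: eq_big => [C|C /andP[CF /eqP Ck]].
  case: (boolP (C \in _)) => //= /(order_complex_card r0) Cr.
  by rewrite -val_eqE /= inordK.
have kC : #|C| = k by rewrite -Ck inordK // ltnS order_complex_card.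
congr (_ *: _); rewrite !rmorphM /= map_polyC /= rmorphXn /= map_polyX rmorphXn /=.
rewrite rmorphB /= rmorph1 map_polyX kC -mulrA mul_polyC; congr (_ *: _).
by rewrite /horner_eval horner_prod.
Qed.
End Matroid.

(** * The h-polynomial of the subdivided crosspolytope *)

(** The number of chains of [k] nonempty proper subsets in a set with [m]
    elements, sorted by the size of the largest one. *)
Fixpoint boolean_chains k m : nat :=
  if k is k'.+1 then \sum_(j < m | (0 < j)%N) 'C(m, j) * boolean_chains k' j else 1%N.

(** The number of chains of [k] nonempty faces of the boundary of the
    crosspolytope of dimension [d]: the face lattice below a face with [j]
    vertices is Boolean, and there are ['C(d, j) * 2 ^ j] of these. *)
Definition cross_chains d k : nat :=
  if k is k'.+1 then \sum_(j < d.+1 | (0 < j)%N) 'C(d, j) * 2 ^ j * boolean_chains k' j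
  else 1%N.

Section Cross.
Variable n : nat.
Implicit Types (s : {set 'I_n * bool}) (A B : {set 'I_n}).
Local Notation K := (cross_polytope_boundary n).

(** A face is encoded by its set [A] of coordinates and the set [B] of those
    where it uses the positive vertex. *)
Definition face_of A B : {set 'I_n * bool} :=
  [set x | (x.1 \in A) && (x.2 == (x.1 \in B))].

Definition support s : {set 'I_n} := [set i | ((i, true) \in s) || ((i, false) \in s)].
Definition positive s : {set 'I_n} := [set i | (i, true) \in s].

Lemma card_face_of A B : #|face_of A B| = #|A|.
Proof.
have -> : face_of A B = [set (i, i \in B) | i in A].
  apply/setP => -[i b]; rewrite !inE /=; apply/andP/imsetP => [[iA /eqP->]|[j jA [-> ->]]].
    by exists i.
  by rewrite jA.
by rewrite card_imset // => i j [].
Qed.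

Lemma face_ofK A B : B \subset A -> support (face_of A B) = A /\ positive (face_of A B) = B.
Proof.
move=> /subsetP BA; split; apply/setP => i; rewrite !inE /=.
  by case: (i \in B); case: (i \in A).
by case: (boolP (i \in B)) => [/BA->|]; rewrite ?andbF.
Qed.

Lemma supportK s : s \in K -> face_of (support s) (positive s) = s.
Proof.
rewrite inE => /forallP sK; apply/setP => -[i b]; rewrite !inE /=; have := sK i.
by case: b; case: ((i, true) \in s); case: ((i, false) \in s).
Qed.

Lemma face_of_cross A B : face_of A B \in K.
Proof. by rewrite inE; apply/forallP => i; rewrite !inE /=; case: (i \in B); rewrite ?andbF. Qed.

Lemma positive_sub s : positive s \subset support s.
Proof. by apply/subsetP => i; rewrite !inE => ->. Qed.

Lemma card_cross s : s \in K -> #|s| = #|support s|.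
Proof. by move=> sK; rewrite -{1}(supportK sK) card_face_of. Qed.

Lemma cross_sub s s' : s' \in K -> s \subset s' -> s \in K.
Proof.
rewrite !inE => /forallP sK /subsetP ss; apply/forallP => i; apply: contra (sK i).
by move=> /andP[/ss-> /ss->].
Qed.

Lemma cross_le s : s \in K -> (#|s| <= n)%N.
Proof. by move=> /card_cross->; rewrite -[n in leqRHS]card_ord max_card. Qed.

Lemma card_cross_faces j : #|[set s in K | #|s| == j]| = ('C(n, j) * 2 ^ j)%N.
Proof.
rewrite -sum1_card.
rewrite (partition_big support (fun A : {set 'I_n} => #|A| == j)) /=; last first.
  by move=> s; rewrite inE => /andP[sK]; rewrite card_cross.
rewrite (eq_bigr (fun=> (2 ^ j)%N)) => [|A /eqP Aj].
  by rewrite sum_nat_const -[n in RHS]card_ord -card_draws cardsE.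
rewrite (reindex_onto (face_of A) positive) /=; last first.
  by move=> s /andP[]; rewrite inE => /andP[sK _] /eqP <-; rewrite supportK.
rewrite (eq_bigl (mem (powerset A))) => [|B].
  by rewrite sum1_card card_powerset Aj.
rewrite /= powersetE in_set face_of_cross card_face_of Aj eqxx /=.
apply/andP/idP => [[/eqP sA /eqP pB]|BA].
  by have := positive_sub (face_of A B); rewrite sA pB.
by have [-> ->] := face_ofK BA; rewrite !eqxx.
Qed.

End Cross.

Lemma sum_proper_subsets (T : finType) (Y : {set T}) (f : nat -> rat) :
  \sum_(X : {set T} | (X != set0) && (X \proper Y)) f #|X| =
  \sum_(j < #|Y| | (0 < j)%N) 'C(#|Y|, j)%:R * f j.
Proof.
rewrite [RHS](eq_bigr (fun j : 'I__ =>
  \sum_(X in [set X : {set T} | (X \subset Y) && (#|X| == j)]) f #|X|)).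
  rewrite (exchange_big_dep (fun X : {set T} => (X != set0) && (X \proper Y))) /=; last first.
    move=> j X j0; rewrite inE => /andP[XY /eqP Xj].
    by rewrite -card_gt0 Xj j0 properEcard XY Xj ltn_ord.
  apply: eq_bigr => X /andP[X0 XY].
  rewrite (big_pred1 (Ordinal (proper_card XY))) // => j.
  rewrite inE proper_sub //= -val_eqE /= eq_sym; case: eqP => [->|]; rewrite ?andbF //.
  by rewrite card_gt0 X0.
move=> j _; rewrite -cards_draws -sum1_card natr_sum mulr_suml.
by apply: eq_bigr => X; rewrite inE => /andP[_ /eqP->]; rewrite mul1r.
Qed.

Lemma sum_cross_faces n (f : nat -> rat) :
  \sum_(X in cross_polytope_boundary n :\ set0) f #|X| =
  \sum_(j < n.+1 | (0 < j)%N) ('C(n, j) * 2 ^ j)%:R * f j.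
Proof.
rewrite (partition_big (fun X : {set 'I_n * bool} => inord #|X| : 'I_n.+1)
  (fun j => (0 < j)%N)) /=; last first.
  by move=> X /setD1P[X0 XK]; rewrite inordK ?card_gt0 // ltnS cross_le.
apply: eq_bigr => j j0; rewrite -card_cross_faces -sum1_card natr_sum mulr_suml.
have KP X : X \in cross_polytope_boundary n -> (inord #|X| : 'I_n.+1) = #|X| :> nat.
  by move=> XK; rewrite inordK // ltnS cross_le.
apply: eq_big => [X|X /andP[/setD1P[_ /KP XK] /eqP<-]]; last by rewrite XK mul1r.
rewrite in_setD1 [RHS]inE; case: (boolP (X \in _)) => [/KP XK|]; rewrite ?andbF //.
rewrite andbT -[inord _ == j]val_eqE /= XK -cards_eq0.
by case: (eqVneq #|X| j) => [->|]; rewrite ?andbF // -lt0n j0.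
Qed.

Lemma boolean_chain_sum (T : finType) (Q : {set {set T}}) k (Y : {set T}) :
  (forall X : {set T}, X \proper Y -> X != set0 -> X \in Q) -> set0 \notin Q ->
  chain_sum (fun _ _ => 1 : rat) Q set0 k Y = (boolean_chains k #|Y|)%:R.
Proof.
move=> QY Q0; elim: k Y QY => [|k IHk] Y QY //=.
rewrite (eq_bigl (fun X : {set T} => (X != set0) && (X \proper Y))) => [|X]; last first.
  case: (boolP (X \proper Y)) => XY; rewrite ?andbF ?andbT //.
  by apply/idP/idP => [|/(QY _ XY)//]; apply: contraTneq => ->.
rewrite (eq_bigr (fun X : {set T} => (boolean_chains k #|X|)%:R)) => [|X /andP[X0 XY]]; last first.
  by rewrite mulr1 IHk // => Z ZX; apply: QY; apply: proper_trans ZX XY.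
rewrite (sum_proper_subsets Y (fun m => (boolean_chains k m)%:R)) natr_sum.
by apply: eq_bigr => j _; rewrite natrM.
Qed.

Lemma cross_chain_sum n k : (0 < n)%N ->
  chain_sum (fun _ _ => 1 : rat) (cross_polytope_boundary n :\ set0) set0 k setT =
  (cross_chains n k)%:R.
Proof.
move=> n0; case: k => //= k.
rewrite (eq_bigl (mem (cross_polytope_boundary n :\ set0))) => [|X]; last first.
  apply: andb_idr => /setD1P[_ XK]; rewrite properT; apply: contraTneq XK => ->.
  by rewrite inE; apply/forallPn; exists (Ordinal n0); rewrite !inE.
rewrite (eq_bigr (fun X : {set _} => (boolean_chains k #|X|)%:R)) => [|X /setD1P[X0 XK]].
  rewrite (sum_cross_faces n (fun m => (boolean_chains k m)%:R)) natr_sum.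
  by apply: eq_bigr => j _; rewrite -natrM.
rewrite mulr1 boolean_chain_sum // ?setD11 // => Z ZX Z0.
by rewrite in_setD1 Z0 (cross_sub XK (proper_sub ZX)).
Qed.

Local Notation subd n := (barycentric_subdivision (cross_polytope_boundary n)).

Lemma card_subdivision n k : (0 < n)%N ->
  #|[set C in subd n | #|C| == k]| = cross_chains n k.
Proof.
move=> n0; apply/eqP; rewrite -(eqr_nat rat) -cross_chain_sum // -sum_chain_weight.
have -> : [set X in cross_polytope_boundary n :\ set0 | X \proper setT] =
    cross_polytope_boundary n :\ set0.
  apply/setP => X; rewrite inE; apply: andb_idr => /setD1P[_ XK]; rewrite properT.
  apply: contraTneq XK => ->.
  by rewrite inE; apply/forallPn; exists (Ordinal n0); rewrite !inE.
rewrite -sum1_card natr_sum; apply/eqP; apply: eq_big => [C|C _]; first by rewrite inE.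
by rewrite /chain_weight big1.
Qed.

Lemma boolean_chains_gt0 k m : (k < m)%N -> (0 < boolean_chains k m)%N.
Proof.
elim: k m => // k IHk m km /=.
by rewrite (bigD1 (Ordinal km)) //= addn_gt0 muln_gt0 IHk // bin_gt0 ltnW.
Qed.

Lemma cross_chains_gt0 n : (0 < cross_chains n n)%N.
Proof.
case: n => // n /=.
by rewrite (bigD1 ord_max) //= addn_gt0 !muln_gt0 bin_gt0 leqnn expn_gt0 boolean_chains_gt0.
Qed.

(** The members of a chain have distinct sizes between 1 and [n]. *)
Lemma chain_card_le n C : C \in subd n -> (#|C| <= n)%N.
Proof.
move=> /order_complexP[CK ch].
have CP X : X \in C -> (X != set0) && (#|X| <= n)%N.
  by move=> /CK /setD1P[-> XK]; rewrite cross_le.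
pose g (X : {set 'I_n * bool}) : 'I_n.+1 := inord #|X|.
have gE X : X \in C -> g X = #|X| :> nat by move=> /CP/andP[_ Xn]; rewrite inordK.
have ginj : {in C &, injective g}.
  move=> X Y XC YC /(congr1 val) /=; rewrite !gE // => XY; apply/eqP.
  have /orP[H|H] := ch _ _ XC YC; first by rewrite eqEcard H /= XY leqnn.
  by rewrite eq_sym eqEcard H /= XY leqnn.
rewrite -(card_in_imset ginj).
have nE : #|predC1 (ord0 : 'I_n.+1)| = n by rewrite cardC1 card_ord.
rewrite -[X in (_ <= X)%N]nE; apply/subset_leq_card/subsetP => _ /imsetP[X XC ->].
rewrite inE -val_eqE /= gE // cards_eq0; by have /andP[] := CP _ XC.
Qed.

Lemma complex_size_subdivision n : (0 < n)%N -> complex_size (subd n) = n.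
Proof.
move=> n0; apply/eqP; rewrite eqn_leq; apply/andP; split.
  by apply/bigmax_leqP => C; apply: chain_card_le.
have := cross_chains_gt0 n; rewrite -card_subdivision // card_gt0 => /set0Pn[C].
rewrite inE => /andP[CK /eqP {1}<-]; rewrite /complex_size (bigD1 C) //=.
exact: leq_maxl.
Qed.

Lemma eulerianBE r : (1 < r)%N ->
  eulerianB r = h_of_f r.-1 (fun k => (cross_chains r.-1 k)%:R).
Proof.
case: r => // -[//|n] _; rewrite /eulerianB /h_poly complex_size_subdivision //.
apply: eq_bigr => k _; congr (_ *: _); rewrite /f_poly complex_size_subdivision //.
rewrite coef_sum (bigD1 k) //= coefZ coefXn eqxx mulr1 card_subdivision //.
rewrite big1 ?addr0 // => j jk; rewrite coefZ coefXn.
by rewrite eq_sym val_eqE (negPf jk) mulr0.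
Qed.

Lemma cross_chains1 n : (cross_chains n 1)%:R = \sum_(j < n.+1 | (0 < j)%N) 2 ^+ j * 'C(n, j)%:R :> rat.
Proof.
by rewrite /= natr_sum; apply: eq_bigr => j _; rewrite muln1 mulnC natrM natrX.
Qed.

(** * The bounds *)

Lemma boolean_chainsS k m : boolean_chains k.+1 m =
  (\sum_(j < m) if 0 < j then 'C(m, j) * boolean_chains k j else 0)%N.
Proof. exact: big_mkcond. Qed.

Lemma cross_chainsS d k : cross_chains d k.+1 =
  (\sum_(j < d.+1) if 0 < j then 'C(d, j) * 2 ^ j * boolean_chains k j else 0)%N.
Proof. exact: big_mkcond. Qed.

Local Arguments boolean_chains : simpl never.

Lemma cross_chains_2 : (cross_chains 2 1 = 8)%N /\ (cross_chains 2 2 = 8)%N.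
Proof.
by split; rewrite cross_chainsS;
  do 2!rewrite ?boolean_chainsS ?big_ord_recl ?big_ord0 /bump /= ?add1n ?addn0.
Qed.

Lemma cross_chains_3 :
  [/\ cross_chains 3 1 = 26, cross_chains 3 2 = 72 & cross_chains 3 3 = 48]%N.
Proof.
by split; rewrite cross_chainsS;
  do 4!rewrite ?boolean_chainsS ?big_ord_recl ?big_ord0 /bump /= ?add1n ?addn0.
Qed.

Lemma poly_lt_scale (p q s : {poly rat}) a b : (forall i, 0 <= q`_i) -> q != 0 -> a < b ->
  poly_lt (p + a%:P * q + s) (p + b%:P * q + s).
Proof.
move=> q_ge0 q_neq0 ab; split.
  by move=> i; rewrite !coefD !coefCM lerD2r lerD2l ler_wpM2r // ltW.
move=> /addIr/addrI/eqP; rewrite -subr_eq0 -mulrBl -polyCB mulf_eq0 (negPf q_neq0) orbF.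
by rewrite polyC_eq0 subr_eq0 lt_eqF.
Qed.

Section Bounds.
Variables (T : finType) (M : matroid T).
Local Notation L := (flats M).
Local Notation E := (ground M).
Local Notation r := (rank M).
Let LP := flatsP M.
Let BL := bot_flat LP.
Let EL := ground_flat LP.
Let BE := bot_sub EL.

Lemma topes_gt0 : 0 < topes L (bot L) E.
Proof. exact: lt_le_trans (topes_ge1 LP BL EL BE). Qed.

Lemma flag_ratio0 : flag_ratio M 0 = 1.
Proof. by rewrite /flag_ratio flag_sum0 divff // gt_eqF // topes_gt0. Qed.

Lemma flag_ratio1_lt : (2 < r)%N -> flag_ratio M 1 < (cross_chains r.-1 1)%:R.
Proof.
move=> r3; rewrite /flag_ratio ltr_pdivrMr ?topes_gt0 // flag_sum1 // cross_chains1.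
rewrite [in ltRHS]big_mkcond [in ltRHS]big_ord_recl /= add0r mulr_suml; apply: ltr_sum => [|i _].
  have r1 : (0 < r.-1)%N by rewrite ltn_predRL ltnW.
  by apply/hasP; exists (Ordinal r1); rewrite ?mem_index_enum.
rewrite -(conv_bot LP) /bump /= add1n; apply: face_sum_lt => //=.
by have := ltn_ord i; rewrite ltn_predRL.
Qed.

Lemma coef1_lt_eulerianB : (2 < r)%N ->
  (normalized_coarse_flag_poly M)`_1 < (eulerianB r)`_1.
Proof.
move=> r3; rewrite normalized_coarse_flag_polyE ?(ltn_trans _ r3) // eulerianBE ?(ltn_trans _ r3) //.
have r1 : (0 < r.-1)%N by rewrite -ltnS (ltn_predK r3) (ltn_trans _ r3).
by rewrite !coef1_h_of_f // flag_ratio0 /= ltrD2r flag_ratio1_lt.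
Qed.

(** Both bounds are statements on the coefficient [flag_ratio M 1 - 2], which is
    [2 * face_sum 2 / topes - 2]. *)
Lemma flag_bounds_rank3 : r = 3%N -> flag_bounds M.
Proof.
move=> rE; have r3 : (2 < r)%N by rewrite rE.
have [c1 c2] := cross_chains_2.
have E2 : eulerianB 3 = 1 + (8 - 2)%:P * 'X + 'X^2.
  by rewrite eulerianBE // h_of_f2; rewrite ?c1 ?c2.
have [f1 f2] := flag_sum_rk3 LP EL rE.
have NE : normalized_coarse_flag_poly M = 1 + (flag_ratio M 1 - 2)%:P * 'X + 'X^2.
  by rewrite normalized_coarse_flag_polyE rE //= h_of_f2 ?flag_ratio0 // /flag_ratio f2 f1.
have X0 : 'X != 0 :> {poly rat} by rewrite polyX_eq0.
have Xge i : 0 <= 'X`_i :> rat by rewrite coefX.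
rewrite /flag_bounds rE NE E2; split.
  have -> : (1 + 'X) ^+ 3.-1 = 1 + 2%:P * 'X + 'X^2 :> {poly rat}.
    by rewrite polyC_natr /=; ring.
  apply: poly_lt_scale Xge X0 _; rewrite ltrBrDr /flag_ratio ltr_pdivlMr ?topes_gt0 // f1.
  have := face_sum_coatoms_gt LP r3; rewrite [rk L E]rE (conv_bot LP) /=; lra.
apply: poly_lt_scale Xge X0 _; rewrite ltrD2r.
by have := flag_ratio1_lt r3; rewrite rE c1.
Qed.

(** The lower bound uses [conv4]: the average numbers of vertices, edges and
    facets of a tope satisfy Euler's formula, so that it is enough that vertices
    and facets add up to more than four. *)
Lemma flag_bounds_rank4 : r = 4%N -> flag_bounds M.
Proof.
move=> rE; have r3 : (2 < r)%N by rewrite rE.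
have [c1 c2 c3] := cross_chains_3.
have E3 : eulerianB 4 = 1 + (26 - 3)%:P * ('X + 'X^2) + 'X^3.
  by rewrite eulerianBE // h_of_f3; rewrite ?c1 ?c2 ?c3 //; lra.
have [f1 f2 f3] := flag_sum_rk4 LP rE; have t0 := topes_gt0.
have t1 : topes L (bot L) E != 0 by rewrite gt_eqF.
have NE : normalized_coarse_flag_poly M = 1 + (flag_ratio M 1 - 3)%:P * ('X + 'X^2) + 'X^3.
  rewrite normalized_coarse_flag_polyE rE //= h_of_f3 ?flag_ratio0 // /flag_ratio f1 ?f2 ?f3; by field.
have X0 : 'X + 'X^2 != 0 :> {poly rat}.
  by apply/eqP => /(congr1 (fun p : {poly rat} => p`_1)); rewrite coefD coefX coefXn coef0.
have Xge i : 0 <= ('X + 'X^2 : {poly rat})`_i by rewrite coefD coefX coefXn addr_ge0 ?ler0n.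
rewrite /flag_bounds rE NE E3; split.
  have -> : (1 + 'X) ^+ 4.-1 = 1 + 3%:P * ('X + 'X^2) + 'X^3 :> {poly rat}.
    by rewrite polyC_natr /=; ring.
  apply: poly_lt_scale Xge X0 _; rewrite ltrBrDr /flag_ratio ltr_pdivlMr // f1.
  have := face_sum_coatoms_gt LP r3; have := face_sum1_ge LP.
  rewrite [rk L E]rE !(conv_bot LP) /= => /(_ isT isT).
  by have := conv4 LP BL EL BE; rewrite (rk_bot LP) [rk L E]rE => /(_ erefl); lra.
apply: poly_lt_scale Xge X0 _; rewrite ltrD2r.
by have := flag_ratio1_lt r3; rewrite rE c1.
Qed.
End Bounds.

(** * Uniform matroids *)

Lemma sum_subsets (T : finType) (A : {set T}) (f : nat -> rat) :
  \sum_(X : {set T} | X \subset A) f #|X| = \sum_(j < #|A|.+1) 'C(#|A|, j)%:R * f j.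
Proof.
rewrite (partition_big (fun X : {set T} => inord #|X| : 'I_#|A|.+1) predT) //=.
apply: eq_bigr => j _; rewrite -cards_draws -[in RHS]sum1_card natr_sum mulr_suml.
have XA (X : {set T}) : X \subset A -> (inord #|X| : 'I_#|A|.+1) = #|X| :> nat.
  by move=> XA; rewrite inordK // ltnS subset_leq_card.
apply: eq_big => [X|X /andP[/XA XE /eqP<-]]; last by rewrite XE mul1r.
by rewrite inE; case: (boolP (X \subset A)) => //= /XA XE; rewrite -val_eqE /= XE.
Qed.

Section Uniform.
Variables (r' n : nat).
Local Notation r := r'.+1.
Hypothesis rn : (r <= n)%N.
Implicit Types (X Y Z F G H : {set 'I_n}).

(** The ground set has [n] elements and the rank is [r = r'.+1]; a set with [r]
    elements spans. *)
Definition uniform_flats : {set {set 'I_n}} :=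
  [set X : {set 'I_n} | (#|X| < r)%N || (X == setT)].
Local Notation U := uniform_flats.

Lemma small_flat X : (#|X| < r)%N -> X \in U.
Proof. by move=> Xr; rewrite inE Xr. Qed.

Lemma large_flat X : X \in U -> (r <= #|X|)%N -> X = setT.
Proof. by rewrite inE ltnNge => /orP[/negPf->|/eqP]. Qed.

Lemma uniform_proper F G : F \in U -> F \proper G -> (#|F| < r)%N.
Proof.
rewrite inE => /orP[//|/eqP->]; by rewrite properE subsetT andbC; case: (G \subset _) (subsetT G).
Qed.

Lemma uniform_setU F e : (#|F| < r')%N -> e |: F \in U.
Proof.
move=> Fr; apply: small_flat; rewrite ltnS (leq_trans _ Fr) //.
by rewrite cardsU1; case: (e \in F) => //=; rewrite ltnW.
Qed.

Lemma uniform_setT : setT \in U.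
Proof. by rewrite inE eqxx orbT. Qed.

Lemma uniform_is_flats : is_flats setT U.
Proof.
split.
- by move=> F _; apply: subsetT.
- exact: uniform_setT.
- move=> F G; rewrite [F \in U]inE => /orP[Fr _|/eqP->]; last by rewrite setTI.
  by apply: small_flat; apply: leq_ltn_trans Fr; rewrite subset_leq_card ?subsetIl.
move=> F e FU; rewrite inE inE => /andP[eF _].
have Fr : (#|F| < r)%N.
  by apply: (uniform_proper FU (G := setT)); rewrite properT; apply: contraNneq eF => ->; rewrite inE.
have [Fr'|rF] := ltnP #|F| r'.
  exists (e |: F); split=> [|G [[_ GU FG Gcov] eG]].
    split; last exact: setU11.
    split; rewrite ?uniform_setU //; first by apply: properUr; rewrite sub1set.
    move=> H _ /proper_card FH; apply/negP => /proper_card; rewrite cardsU1 eF add1n ltnS.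
    by rewrite leqNgt FH.
  have FeG : e |: F \subset G by rewrite subUset sub1set eG proper_sub.
  have := Gcov _ (uniform_setU e Fr').
  rewrite properE subsetUr subUset sub1set subxx (negPf eF) => /(_ isT).
  by rewrite properE FeG negbK => GF; apply/eqP; rewrite eqEsubset FeG.
exists setT; split=> [|G [[_ GU FG Gcov] eG]].
  split; last by rewrite inE.
  split=> //; first exact: uniform_setT.
    by rewrite properT; apply: contraNneq eF => ->; rewrite inE.
  move=> H HU /proper_card FH; rewrite (large_flat HU) ?properxx //.
  exact: leq_ltn_trans rF FH.
by rewrite (large_flat GU) // (leq_ltn_trans rF) ?proper_card.
Qed.

Definition uniform_matroid := Matroid uniform_is_flats.
Let UP := uniform_is_flats.

Lemma uniform_bot : bot U = set0.
Proof. by apply/eqP; rewrite -subset0; apply: bigcap_inf; rewrite inE cards0. Qed.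

Lemma rk_uniform X : X \in U -> rk U X = minn #|X| r.
Proof.
apply: (graded_rk UP (rho := fun X => minn #|X| r)); last by rewrite uniform_bot cards0 min0n.
move=> F G [FU GU FG Gcov]; have Fr := uniform_proper FU FG.
have [e eG eF] : exists2 e, e \in G & e \notin F by case/properP: FG.
have FeF : F \proper e |: F.
  by rewrite properE subsetUr subUset sub1set subxx (negPf eF).
have FeG : e |: F \subset G by rewrite subUset sub1set eG proper_sub.
rewrite (minn_idPl (ltnW Fr)).
have [Fr'|rF] := ltnP #|F| r'.
  have := Gcov _ (uniform_setU e Fr') FeF; rewrite properE FeG negbK => GF.
  have -> : G = e |: F by apply/eqP; rewrite eqEsubset FeG GF.
  by rewrite cardsU1 eF add1n; apply/minn_idPl.
have rE : #|F| = r' by apply/eqP; rewrite eqn_leq rF -ltnS Fr.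
by rewrite rE; apply/minn_idPr; rewrite -rE proper_card.
Qed.

Lemma rank_uniform : rank uniform_matroid = r.
Proof. by rewrite /rank rk_uniform ?uniform_setT //= cardsT card_ord; apply/minn_idPr. Qed.

(** Below a proper flat the lattice is Boolean, and the Weisner recursion has a
    single term. *)
Lemma amu_uniform X Y : (#|Y| < r)%N -> X \subset Y -> amu U X Y = 1.
Proof.
have [m] := ubnP #|Y|; elim: m Y => // m IHm Y Ym Yr XY.
have XU : X \in U by apply: small_flat; apply: leq_ltn_trans Yr; apply: subset_leq_card.
have [YX|/subsetPn[e eY eX]] := boolP (Y \subset X).
  by have -> : Y = X; [apply/eqP; rewrite eqEsubset YX | rewrite amu_xx].
have YU := small_flat Yr.
have cY : #|Y :\ e|.+1 = #|Y| by rewrite [RHS](cardsD1 e) eY.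
have Yer : (#|Y :\ e| < r)%N by rewrite ltnW // cY.
rewrite (weisner UP XU YU XY eY eX) (big_pred1 (Y :\ e)) => [|H /=].
  by apply: IHm; rewrite ?subsetD1 ?XY ?eX // -ltnS cY.
apply/andP/eqP => [[HC XH]|->].
  have [HU eH HY] := coP UP (in_setT e) HC.
  have Hr := leq_trans (proper_card HY) (ltnW Yr).
  rewrite !rk_uniform // (minn_idPl (ltnW Yr)) (minn_idPl (ltnW Hr)) -cY => -[cH].
  by apply/eqP; rewrite eqEcard cH leqnn andbT subsetD1 proper_sub.
rewrite subsetD1 XY eX; split=> //; rewrite !inE eqxx Yer /= eqEsubset jn_min ?subD1set //=.
by rewrite -{1}(setD1K eY) subUset sub1set mem_jn sub_jn.
Qed.

Lemma between_small X Y : (#|Y| < r)%N -> forall Z,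
  (Z \in between U X Y) = (X \subset Z) && (Z \subset Y).
Proof.
move=> Yr Z; rewrite betweenE; apply: andb_idl => /andP[_ ZY].
by apply: small_flat; apply: leq_ltn_trans Yr; apply: subset_leq_card.
Qed.

Lemma sum_above X Y (f : nat -> rat) : X \subset Y ->
  \sum_(Z : {set 'I_n} | (X \subset Z) && (Z \subset Y)) f #|Z| =
  \sum_(j < (#|Y| - #|X|).+1) 'C(#|Y| - #|X|, j)%:R * f (#|X| + j)%N.
Proof.
move=> XY; have cD : #|Y :\: X| = (#|Y| - #|X|)%N by rewrite cardsD (setIidPr XY).
rewrite -cD -(sum_subsets _ (fun j => f (#|X| + j)%N)).
rewrite (reindex_onto (fun W => X :|: W) (fun Z => Z :\: X)) /=; last first.
  by move=> Z /andP[XZ _]; rewrite setUC setDKU.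
apply: eq_big => [W|W].
  by rewrite subsetUl subUset XY /= setDUl setDv set0U subsetD (sameP eqP setDidPl).
rewrite setDUl setDv set0U => /andP[_ /eqP/setDidPl WX]; congr f.
by rewrite cardsU setIC (disjoint_setI0 WX) cards0 subn0.
Qed.

Lemma topes_uniform X Y : (#|Y| < r)%N -> X \subset Y -> topes U X Y = 2 ^+ (#|Y| - #|X|).
Proof.
move=> Yr XY; rewrite /topes (eq_bigl _ _ (between_small X Yr)).
rewrite (eq_bigr (fun=> 1)) => [|Z /andP[XZ ZY]].
  rewrite (sum_above (fun=> 1) XY) -[2]/(1 + 1) exprDn; apply: eq_bigr => j _.
  by rewrite !expr1n mulr1.
by rewrite amu_uniform // (leq_ltn_trans (subset_leq_card ZY)).
Qed.

Let UT := uniform_setT.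
Let U0 := uniform_bot.

Lemma flag_sum_uniform k X : (#|X| < r)%N ->
  flag_sum setT U k X = 2 ^+ #|X| * (boolean_chains k #|X|)%:R.
Proof.
rewrite /flag_sum U0; elim: k X => [|k IHk] X Xr.
  by rewrite /= topes_uniform ?sub0set // cards0 subn0 mulr1.
rewrite [LHS]/= (eq_bigl (fun Z : {set 'I_n} => (Z != set0) && (Z \proper X))) => [|Z]; last first.
  case: (boolP (Z \proper X)) => ZX; rewrite ?andbF ?andbT // !inE.
  have Zr : (#|Z| < r)%N := ltn_trans (proper_card ZX) Xr.
  rewrite Zr negb_or andbT; apply: andb_idr => _; apply: contraTneq Zr => ->.
  by rewrite cardsT card_ord -leqNgt.
have -> : (boolean_chains k.+1 #|X|)%:R =
    \sum_(j < #|X| | (0 < j)%N) 'C(#|X|, j)%:R * (boolean_chains k j)%:R :> rat.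
  by rewrite /= natr_sum; apply: eq_bigr => j _; rewrite natrM.
rewrite -(sum_proper_subsets X (fun j => (boolean_chains k j)%:R)) mulr_sumr.
apply: eq_bigr => Z /andP[_ ZX]; have Zr : (#|Z| < r)%N := ltn_trans (proper_card ZX) Xr.
rewrite IHk // topes_uniform ?proper_sub // mulrAC -exprD subnKC //.
by rewrite subset_leq_card ?proper_sub.
Qed.

Lemma sum_uniform_parity (f : nat -> rat) :
  \sum_(Y in U | odd (rk U Y) == odd r') f #|Y| =
  \sum_(s < r | odd s == odd r') 'C(n, s)%:R * f s.
Proof.
have UE (Y : {set 'I_n}) : (Y \in U) && (odd (rk U Y) == odd r') = (#|Y| < r)%N && (odd #|Y| == odd r').
  case: (ltnP #|Y| r) => Yr /=.
    by rewrite small_flat // rk_uniform ?small_flat // (minn_idPl (ltnW Yr)).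
  apply/negP => /andP[YU]; rewrite (large_flat YU Yr) -[rk _ _]/(rank uniform_matroid) rank_uniform /=.
  by case: (odd r').
rewrite (big_ord_widen_cond n.+1 (fun s => odd s == odd r') (fun s => 'C(n, s)%:R * f s)); last first.
  exact: leq_trans rn _.
rewrite big_mkcond /= [RHS]big_mkcond /=.
have cT : #|[set: 'I_n]| = n by rewrite cardsT card_ord.
pose f' s := if (s < r)%N && (odd s == odd r') then f s else 0.
transitivity (\sum_(Y : {set 'I_n} | Y \subset setT) f' #|Y|).
  by apply: eq_big => [Y|Y _]; rewrite ?subsetT ?UE.
rewrite sum_subsets cT; apply: eq_bigr => s _; rewrite /f' andbC.
by case: ifP; rewrite ?mulr0.
Qed.

(** By parity the top may be replaced by the proper flats Y of the parity of
    [r - 1]; the weight of a flag below Y is a power of 2 that turns chains of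
    subsets of Y into chains of faces of a crosspolytope boundary. *)
Lemma flag_sum_uniform_top k : flag_sum setT U k setT =
  2 * \sum_(s < r | odd s == odd r') 'C(n, s)%:R * (cross_chains s k)%:R.
Proof.
have rkT : rk U setT = r by rewrite -[LHS]/(rank uniform_matroid) rank_uniform.
have TP : set0 \proper [set: 'I_n].
  by rewrite properT eq_sym -card_gt0 cardsT card_ord (leq_trans _ rn).
have smallY Y : Y \in U -> odd (rk U Y) == odd r' -> (#|Y| < r)%N.
  move=> YU; rewrite ltnNge; apply: contraL => /(large_flat YU)->.
  by rewrite rkT /=; case: (odd r').
rewrite -(sum_uniform_parity (fun s => (cross_chains s k)%:R)).
case: k => [|k].
  rewrite flag_sum0 U0 (@topes_parity _ U (odd r')) ?UT ?small_flat ?cards0 //.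
  congr (2 * _); apply: eq_big => [Y|Y /andP[]].
    by rewrite betweenE sub0set subsetT !andbT.
  rewrite betweenE => /and3P[YU _ _] /(smallY Y YU) Yr.
  by rewrite amu_uniform ?sub0set.
rewrite /flag_sum U0 [LHS]/=.
rewrite (eq_bigl (fun X => (X \in U) && ((X != set0) && (X \proper setT)))); last first.
  by move=> X; rewrite !inE properT negb_or; case: (X == setT); rewrite ?andbF ?andbT // andbC.
rewrite (sum_topes_top UP (odd r')); last first.
  by move=> X XU /andP[_ XT]; rewrite rkT rk_uniform // gtn_min (uniform_proper XU XT).
congr (2 * _); apply: eq_bigr => Y /andP[YU oY]; have Yr := smallY Y YU oY.
pose g j : rat := if (0 < j)%N then 2 ^+ j * (boolean_chains k j)%:R else 0.
transitivity (\sum_(X : {set 'I_n} | X \subset Y) g #|X|).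
  rewrite big_mkcond [RHS]big_mkcond /=; apply: eq_bigr => X _.
  rewrite -U0 between_botE U0 /g card_gt0.
  case: (boolP (X \subset Y)) => XY; rewrite ?andbF //= andbT.
  have Xr := leq_ltn_trans (subset_leq_card XY) Yr.
  rewrite small_flat //= properT; case: eqP => //= _.
  have -> : X != setT by apply: contraTneq Xr => ->; rewrite cardsT card_ord -leqNgt.
  by rewrite amu_uniform // mulr1 -flag_sum_uniform // /flag_sum U0.
rewrite sum_subsets natr_sum [RHS]big_mkcond; apply: eq_bigr => j _ /=; rewrite /g.
by case: ifP; rewrite ?mulr0 // !natrM natrX mulrA.
Qed.

End Uniform.

(** * Lattices in which a flat of rank k has q^k elements *)

Definition qint (q k : nat) : nat := \sum_(i < k) q ^ i.

Lemma qint_gt0 q k : (0 < k)%N -> (0 < qint q k)%N.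
Proof. by case: k => // k _; rewrite /qint big_ord_recl. Qed.

Lemma qintS q k : qint q k.+1 = (qint q k + q ^ k)%N.
Proof. by rewrite /qint big_ord_recr. Qed.

Lemma qint_pred q k : (q.-1 * qint q k)%N = (q ^ k).-1.
Proof. by rewrite predn_exp. Qed.

(** The Gaussian binomial coefficient, in the form in which the double counting
    of [rank_countS] produces it. *)
Definition gauss (q k j : nat) : rat := \prod_(i < j) ((qint q (k - i))%:R / (qint q i.+1)%:R).

Lemma gauss0 q k : gauss q k 0 = 1.
Proof. by rewrite /gauss big_ord0. Qed.

Lemma gaussS q k j : gauss q k j.+1 = gauss q k j * ((qint q (k - j))%:R / (qint q j.+1)%:R).
Proof. by rewrite /gauss big_ord_recr. Qed.

Lemma qint_neq0 q j : (qint q j.+1)%:R != 0 :> rat.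
Proof. by rewrite pnatr_eq0 -lt0n qint_gt0. Qed.

Lemma gauss_nn q k : gauss q k k = 1.
Proof.
rewrite /gauss big_split /= (reindex_inj rev_ord_inj) /= -big_split /=.
by rewrite big1 // => i _; rewrite subKn // mulfV // qint_neq0.
Qed.

Lemma gauss_pred q j : gauss q j.+1 j = (qint q j.+1)%:R.
Proof.
have := gaussS q j.+1 j; rewrite gauss_nn subSnn => /esym.
rewrite [qint q 1]big_ord1 mul1r => /(congr1 ( *%R^~ (qint q j.+1)%:R)).
by rewrite mulfVK ?qint_neq0 // mul1r.
Qed.

Section Projective.
Variables (T : finType) (E : {set T}) (L : {set {set T}}) (q : nat).
Hypothesis LP : is_flats E L.
Hypothesis q1 : (1 < q)%N.
Hypothesis cardL : forall X, X \in L -> #|X| = (q ^ rk L X)%N.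
Implicit Types (X Y Z H : {set T}).

Definition rank_count X Y j : nat := #|[set Z in between L X Y | rk L Z == (rk L X + j)%N]|.

(** The elements of [Y] outside [X] are distributed evenly among the flats of
    [Y] that cover [X]. *)
Lemma card_points X Y : X \in L -> Y \in L -> X \subset Y ->
  rank_count X Y 1 = qint q (rk L Y - rk L X).
Proof.
move=> XL YL XY.
have q0 : (0 < q)%N := ltnW q1.
have rXY : (rk L X <= rk L Y)%N := rk_le LP XL YL XY.
have pos : (0 < q.-1 * q ^ rk L X)%N by rewrite muln_gt0 -ltnS prednK // q1 expn_gt0 q0.
apply/eqP; rewrite -(eqn_pmul2r pos) [X in _ == X]mulnCA [X in _ == X]mulnA qint_pred.
have -> : ((q ^ (rk L Y - rk L X)).-1 * q ^ rk L X)%N = #|Y :\: X|.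
  rewrite cardsD (setIidPr XY) !cardL // -subn1 mulnBl mul1n -expnD subnK //.
pose S := [set Z in between L X Y | rk L Z == (rk L X + 1)%N].
rewrite -[X in _ == X]sum1_card [X in _ == X](partition_big (fun e => jn L X e) (mem S)) /=; last first.
  move=> e /setDP[eY eX]; have eE := subsetP (flat_sub LP YL) _ eY.
  by rewrite inE betweenE (jn_flat LP) ?sub_jn ?jn_min //= (rk_jn LP) // addn1.
rewrite [X in _ == X](eq_bigr (fun=> (q.-1 * q ^ rk L X)%N)).
  by rewrite sum_nat_const.
move=> Z; rewrite inE betweenE => /andP[/and3P[ZL XZ ZY] /eqP rZ].
rewrite sum1_card; transitivity #|Z :\: X|.
  apply: eq_card => e; rewrite [LHS]inE /= !inE.
  case: (boolP (e \in X)) => //= eX; apply/andP/idP => [[eY /eqP<-]|eZ]; first exact: mem_jn.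
  have eE := subsetP (flat_sub LP ZL) _ eZ.
  split; first exact: (subsetP ZY).
  apply/eqP/(rk_inj LP); rewrite ?(jn_flat LP) ?jn_min //.
  by rewrite (rk_jn LP) // rZ addn1.
rewrite cardsD (setIidPr XZ) !cardL // rZ addn1 expnS.
by rewrite -subn1 mulnBl mul1n.
Qed.

(** Count the pairs of flats of relative ranks [j] and [j.+1] that are
    comparable, from below and from above. *)
Lemma rank_countS X Y j k : X \in L -> Y \in L -> X \subset Y ->
  (rk L Y - rk L X)%N = k -> (j < k)%N ->
  (rank_count X Y j * qint q (k - j))%N =
  (\sum_(Z in between L X Y | rk L Z == rk L X + j.+1) rank_count X Z j)%N.
Proof.
move=> XL YL XY rk_k jk.
transitivity (\sum_(H in between L X Y | rk L H == (rk L X + j)%N) rank_count H Y 1)%N.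
  rewrite (eq_bigr (fun=> qint q (k - j))) => [|H /andP[]].
    by rewrite big_const iter_addn addn0 mulnC; congr (_ * _)%N; apply: eq_card => H; rewrite inE.
  rewrite betweenE => /and3P[HL XH HY] /eqP rH.
  by rewrite card_points // rH subnDA rk_k.
under eq_bigr do rewrite /rank_count -sum1_card.
under [RHS]eq_bigr do rewrite /rank_count -sum1_card.
rewrite (exchange_big_dep (fun Z => (Z \in between L X Y) && (rk L Z == (rk L X + j.+1)%N)))
  /=; last first.
  move=> H Z /andP[]; rewrite betweenE => /and3P[HL XH HY] /eqP rH.
  rewrite inE betweenE rH addn1 addnS => /andP[/and3P[ZL HZ ZY] ->].
  by rewrite betweenE ZL (subset_trans XH HZ) ZY.
apply: eq_bigr => Z /andP[]; rewrite betweenE => /and3P[ZL XZ ZY] /eqP rZ.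
apply: eq_bigl => H; rewrite !inE ZL ZY rZ addn1 addnS.
case: (boolP (H \in L)) => //= HL; case: (boolP (H \subset Z)) => HZ; rewrite ?andbF ?andbT //=.
rewrite (subset_trans HZ ZY) andbT.
by case: (X \subset H) => //=; case: eqP => //= ->; rewrite eqxx.
Qed.

(** In [rank_countS] the right-hand side counts hyperplanes of shorter
    intervals, whose number the induction on [k] provides. *)
Lemma rank_countE k j X Y : X \in L -> Y \in L -> X \subset Y ->
  (rk L Y - rk L X)%N = k -> (j <= k)%N -> (rank_count X Y j)%:R = gauss q k j.
Proof.
have [n] := ubnP k; elim: n k j X Y => // n IHn k j X Y kn XL YL XY rk_k.
have rXY := rk_le LP XL YL XY.
have rY : rk L Y = (rk L X + k)%N by rewrite -rk_k subnKC.
elim: j => [_|j IHj jk].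
  rewrite gauss0 /rank_count; have -> : [set Z in between L X Y | rk L Z == (rk L X + 0)%N] = [set X].
    apply/setP => Z; rewrite addn0 !inE; apply/andP/eqP => [[/and3P[ZL XZ _] /eqP rZ]|->].
      by apply/esym/(rk_inj LP).
    by rewrite XL subxx XY.
  by rewrite cards1.
have [jk'|kj] := ltnP j.+1 k; last first.
  have jE : j.+1 = k by apply/eqP; rewrite eqn_leq jk kj.
  rewrite jE gauss_nn /rank_count -rY; have -> : [set Z in between L X Y | rk L Z == rk L Y] = [set Y].
    apply/setP => Z; rewrite !inE; apply/andP/eqP => [[/and3P[ZL _ ZY] /eqP rZ]|->].
      exact/(rk_inj LP).
    by rewrite YL subxx XY.
  by rewrite cards1.
have := rank_countS XL YL XY rk_k (ltnW jk').
move=> /(congr1 (fun m : nat => m%:R : rat)); rewrite natrM IHj ?(ltnW jk) // natr_sum.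
rewrite [X in _ = X -> _](eq_bigr (fun=> (qint q j.+1)%:R)) => [|Z /andP[]]; last first.
  rewrite betweenE => /and3P[ZL XZ ZY] /eqP rZ; rewrite -gauss_pred.
  by rewrite (IHn j.+1) ?rZ ?addKn // (leq_trans jk').
rewrite sumr_const => countE; rewrite gaussS mulrA countE -[X in _ / X]/((qint q j.+1)%:R).
rewrite -[(qint q j.+1)%:R *+ _]mulr_natr mulrAC divff ?qint_neq0 // mul1r; congr (_%:R).
by apply: eq_card => Z; rewrite inE.

Qed.

(** Weisner's recursion multiplies by the number of hyperplanes of the interval
    that avoid a point, a difference of consecutive q-integers. *)
Lemma amu_projective X Y : X \in L -> Y \in L -> X \subset Y ->
  amu L X Y = q%:R ^+ 'C(rk L Y - rk L X, 2).
Proof.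
have [n] := ubnP #|Y|; elim: n X Y => // n IHn X Y Yn XL YL XY.
have [YX|/subsetPn[e eY eX]] := boolP (Y \subset X).
  have -> : Y = X by apply/eqP; rewrite eqEsubset YX.
  by rewrite amu_xx // subnn.
have eE := subsetP (flat_sub LP YL) _ eY.
have XpY : X \proper Y by apply/properP; split=> //; exists e.
have rXY := rk_lt LP XL YL XpY.
have [k rY] : exists k, rk L Y = (rk L X + k.+1)%N.
  by exists (rk L Y - rk L X).-1; rewrite prednK ?subn_gt0 // subnKC // ltnW.
rewrite rY addKn binS bin1 exprD.
rewrite (weisner LP XL YL XY eY eX) (eq_bigr (fun=> q%:R ^+ 'C(k, 2))) => [|H]; last first.
  move=> /andP[/(coP LP eE)[HL _ HY rH] XH].
  rewrite IHn // ?(leq_trans (proper_card HY)) //; congr (_ ^+ 'C(_, 2)).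
  by move: rH; rewrite rY addnS => -[<-]; rewrite addKn.
rewrite sumr_const -[LHS]mulr_natr; congr (_ * _).
rewrite -natrX; congr (_%:R).
have JL := jn_flat LP XL eE; have JY := jn_min YL XY eY.
have coE : [set H in co L e Y | X \subset H] =
  [set H in between L X Y | rk L H == (rk L X + k)%N] :\:
    [set H in between L (jn L X e) Y | rk L H == (rk L X + k)%N].
  apply/setP => H; rewrite inE [RHS]inE; apply/andP/andP => [[HC XH]|].
    have [HL eH /proper_sub HY rH] := coP LP eE HC.
    move: rH; rewrite rY addnS => -[rH]; rewrite !inE HL XH HY rH eqxx /=; split=> //.
    by rewrite !andbT; apply: contra eH => /subsetP; apply; apply: mem_jn.
  rewrite !inE => -[+ /andP[/and3P[HL XH HY] /eqP rH]].
  rewrite HL HY rH eqxx !andbT /= => JH.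
  have eH : e \notin H by apply: contra JH => eH; rewrite jn_min.
  rewrite XH eH; split=> //; apply/eqP/(rk_inj LP); rewrite ?(jn_flat LP) ?jn_min //.
  by rewrite (rk_jn LP) // rH rY addnS.
transitivity #|[set H in co L e Y | X \subset H]|.
  by apply: eq_card => H; rewrite [RHS]inE.
rewrite coE cardsD (setIidPr _); last first.
  apply/subsetP => H; rewrite !inE => /andP[/and3P[-> JH ->] ->].
  by rewrite (subset_trans (sub_jn _ _ _) JH).
have cA : #|[set H in between L X Y | rk L H == (rk L X + k)%N]| = qint q k.+1.
  apply/eqP; rewrite -(eqr_nat rat) -gauss_pred.
  by rewrite -[#|_|]/(rank_count X Y k) (@rank_countE k.+1) // rY addKn.
have cB : #|[set H in between L (jn L X e) Y | rk L H == (rk L X + k)%N]| = qint q k.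
  have rJ := rk_jn LP XL eE eX.
  case: k rY {cA coE} => [|k] rY.
    rewrite /qint big_ord0; apply/eqP; rewrite cards_eq0 -subset0; apply/subsetP => H.
    rewrite !inE => /andP[/and3P[HL JH _] /eqP rH].
    by have := rk_le LP JL HL JH; rewrite rJ rH addn0 ltnn.
  apply/eqP; rewrite -(eqr_nat rat) -gauss_pred.
  rewrite -addSnnS -rJ -[#|_|]/(rank_count (jn L X e) Y k) (@rank_countE k.+1) //.
  by rewrite rJ rY -addSnnS addKn.
by rewrite cA cB qintS addKn.
Qed.

Definition projective_topes k : rat := \sum_(j < k.+1) gauss q k j * q%:R ^+ 'C(j, 2).

Fixpoint projective_flags i m : rat :=
  if i is i'.+1 then
    \sum_(j < m.-1) gauss q m j.+1 * projective_flags i' j.+1 * projective_topes (m - j.+1)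
  else projective_topes m.

Lemma topes_projective X Y : X \in L -> Y \in L -> X \subset Y ->
  topes L X Y = projective_topes (rk L Y - rk L X).
Proof.
move=> XL YL XY; rewrite /topes (between_rk_sum LP) //; apply: eq_bigr => j _.
rewrite (eq_bigr (fun=> q%:R ^+ 'C(j, 2))) => [|Z /andP[]]; last first.
  by rewrite betweenE => /and3P[ZL XZ ZY] /eqP rZ; rewrite amu_projective // rZ addKn.
rewrite sumr_const -[LHS]mulr_natl; congr (_ * _).
have jr : (j <= rk L Y - rk L X)%N by rewrite -ltnS.
rewrite -(rank_countE XL YL XY erefl jr) /rank_count; congr (_%:R).
by apply: eq_card => Z; rewrite [RHS]inE.
Qed.

Lemma flag_sum_projective i Y : Y \in L -> flag_sum E L i Y = projective_flags i (rk L Y).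
Proof.
elim: i Y => [|i IHi] Y YL.
  by rewrite flag_sum0 topes_projective ?(bot_flat LP) ?bot_sub // (rk_bot LP) subn0.
rewrite (flag_sumS LP) //=; apply: eq_bigr => j _.
rewrite (eq_bigr (fun=> projective_flags i j.+1 * projective_topes (rk L Y - j.+1))).
  rewrite sumr_const -[LHS]mulr_natl -mulrA; congr (_ * _).
  have rB : (rk L Y - rk L (bot L))%N = rk L Y by rewrite (rk_bot LP) subn0.
  have jr : (j < rk L Y)%N by have := ltn_ord j; rewrite ltn_predRL; apply: ltnW.
  rewrite -(rank_countE (bot_flat LP) YL (bot_sub YL) rB jr) /rank_count; congr (_%:R).
  by apply: eq_card => Z; rewrite [RHS]inE (rk_bot LP).
move=> X /andP[]; rewrite between_botE => /andP[XL XY] /eqP rX.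
by rewrite IHi // topes_projective // rX.
Qed.

End Projective.

(** * The matroid of all vectors over a prime field *)

Section VectorMatroid.
Variables (p n : nat).
Hypothesis p_pr : prime p.
Local Notation V := 'rV['F_p]_n.
Implicit Types (X Y F G H : {set V}) (u v e : V).

(** All vectors form the ground set, so that the zero vector is a loop and
    proportional vectors are parallel. A flat is then literally a subspace, and
    its cardinality is the power of [p] that the preceding part asks for. *)
Definition subspaces : {set {set V}} :=
  [set X : {set V} | (0 \in X) && [forall a : 'F_p, forall u in X, forall v in X, a *: u + v \in X]].
Local Notation S := subspaces.

Lemma subspaceP X :
  reflect (0 \in X /\ forall a u v, u \in X -> v \in X -> a *: u + v \in X) (X \in S).
Proof.
rewrite inE; apply: (iffP andP) => -[X0 XP]; split => //.
  by move=> a u v uX vX; move/forallP: XP => /(_ a)/forall_inP/(_ u uX)/forall_inP; apply.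
by apply/forallP => a; apply/forall_inP => u uX; apply/forall_inP => v; apply: XP.
Qed.

Definition extend F e : {set V} := [set ax.1 *: e + ax.2 | ax in setX [set: 'F_p] F].

Lemma extendP F e v :
  reflect (exists a u, u \in F /\ v = a *: e + u) (v \in extend F e).
Proof.
apply: (iffP imsetP) => [[[a u]]|[a [u [uF ->]]]].
  by rewrite inE /= => /andP[_ uF] ->; exists a, u.
by exists (a, u); rewrite // inE /= inE.
Qed.

Lemma extend_subspace F e : F \in S -> extend F e \in S.
Proof.
move=> /subspaceP[F0 FP]; apply/subspaceP; split.
  by apply/extendP; exists 0, 0; rewrite scale0r addr0.
move=> a _ _ /extendP[b [u [uF ->]]] /extendP[c [v [vF ->]]].
apply/extendP; exists (a * b + c), (a *: u + v); split; first exact: FP.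
by rewrite scalerDr scalerA scalerDl addrACA.
Qed.

Lemma sub_extend F e : F \subset extend F e.
Proof. by apply/subsetP => u uF; apply/extendP; exists 0, u; rewrite scale0r add0r. Qed.

Lemma mem_extend F e : F \in S -> e \in extend F e.
Proof.
by move=> /subspaceP[F0 _]; apply/extendP; exists 1, 0; rewrite scale1r addr0.
Qed.

Lemma extend_min F G e : G \in S -> F \subset G -> e \in G -> extend F e \subset G.
Proof.
move=> /subspaceP[G0 GP] /subsetP FG eG; apply/subsetP => _ /extendP[a [u [uF ->]]].
by apply: GP => //; apply: FG.
Qed.

Lemma card_extend F e : F \in S -> e \notin F -> #|extend F e| = (p * #|F|)%N.
Proof.
move=> /subspaceP[F0 FP] eF; rewrite card_in_imset.
  by rewrite cardsX cardsT card_Fp.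
have FB u v : u \in F -> v \in F -> u - v \in F.
  by move=> uF vF; rewrite addrC -scaleN1r; apply: FP.
move=> [a u] [b v]; rewrite !inE /= => uF vF /eqP.
rewrite -subr_eq0 opprD addrACA -scalerBl addr_eq0 opprB => /eqP ab.
have [ab0|ab0] := eqVneq (a - b) 0.
  move: ab; rewrite ab0 scale0r => /esym/eqP; rewrite subr_eq0 => /eqP->.
  by move/eqP: ab0; rewrite subr_eq0 => /eqP->.
case/negP: eF; rewrite -[e]scale1r -(mulVf ab0) -scalerA ab -[_ *: _]addr0.
by apply: FP => //; apply: FB.
Qed.

(** A vector of [H] outside [F] has a nonzero coordinate at [e], so [H] contains
    [e]. *)
Lemma extend_max F H e : F \in S -> H \in S -> F \proper H -> H \subset extend F e ->
  H = extend F e.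
Proof.
move=> FS HS /properP[FH [h hH hF]] HE; apply/eqP; rewrite eqEsubset HE /=.
apply: extend_min => //; have /extendP[a [u [uF hE]]] := subsetP HE _ hH.
have a0 : a != 0 by apply: contraNneq hF => a0; rewrite hE a0 scale0r add0r.
move/subspaceP: HS => [H0 HP].
have -> : e = a^-1 *: (- 1 *: u + h) + 0.
  by rewrite hE scaleN1r addrCA addNr !addr0 scalerA mulVf // scale1r.
by apply: (HP) => //; apply: (HP) => //; apply: (subsetP FH).
Qed.

Lemma subspaces_is_flats : is_flats setT S.
Proof.
split.
- by move=> F _; apply: subsetT.
- by apply/subspaceP; split => *; rewrite inE.
- move=> F G /subspaceP[F0 FP] /subspaceP[G0 GP]; apply/subspaceP; split.
    by rewrite inE F0 G0.
  by move=> a u v /setIP[uF uG] /setIP[vF vG]; rewrite inE FP ?GP.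
move=> F e FS; rewrite !inE andbT => eF.
have FE : F \proper extend F e.
  by apply/properP; split; [exact: sub_extend | exists e => //; exact: mem_extend].
exists (extend F e); split=> [|G [[_ GS FG Gcov] eG]].
  split; last exact: mem_extend.
  split=> //; first exact: extend_subspace.
  move=> H HS FH; apply/negP => HE; move: (HE).
  by rewrite (extend_max FS HS FH (proper_sub HE)) properxx.
have EG : extend F e \subset G by rewrite extend_min // proper_sub.
have := Gcov _ (extend_subspace e FS) FE; rewrite properE EG negbK => GE.
by apply/eqP; rewrite eqEsubset EG.
Qed.

Definition vector_matroid := Matroid subspaces_is_flats.

Lemma bot_subspaces : bot S = [set 0].
Proof.
apply/eqP; rewrite eqEsubset; apply/andP; split.
  apply: bigcap_inf; apply/subspaceP; split; first exact: set11.
  by move=> a u v /set1P-> /set1P->; rewrite scaler0 addr0 set11.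
by apply/bigcapsP => X /subspaceP[X0 _]; rewrite sub1set.
Qed.

Lemma card_subspace X : X \in S -> #|X| = (p ^ rk S X)%N.
Proof.
have LP := subspaces_is_flats; have BS := bot_flat LP => XS.
have jnE F e : F \in S -> jn S F e = extend F e.
  move=> FS; apply/eqP; rewrite eqEsubset jn_min ?extend_subspace ?sub_extend ?mem_extend //=.
  exact: extend_min (jn_flat LP FS (in_setT e)) (sub_jn _ _ _) (mem_jn _ _ _).
suff cE Z : Z \in S -> Z \subset X -> (#|X| * p ^ rk S Z = #|Z| * p ^ rk S X)%N.
  by have := cE _ BS (bot_sub XS); rewrite (rk_bot LP) bot_subspaces cards1 muln1 mul1n.
move: Z; apply: (flat_lt_ind LP XS) => Z ZS ZX IH.
have [XZ|/subsetPn[e eX eZ]] := boolP (X \subset Z).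
  by have -> : Z = X by apply/eqP; rewrite eqEsubset ZX.
have := IH e eX eZ; rewrite (rk_jn LP ZS (in_setT e) eZ) jnE // card_extend // expnS.
rewrite mulnCA -mulnA => /eqP; rewrite eqn_pmul2l ?prime_gt0 // => /eqP.
exact.
Qed.

Lemma rank_vector_matroid : rank vector_matroid = n.
Proof.
apply: (@expnI p); first exact: prime_gt1.
rewrite -card_subspace ?(ground_flat subspaces_is_flats) //.
by rewrite cardsT card_mx mul1n card_Fp.
Qed.

End VectorMatroid.

(** * Limits of face numbers *)

Import filter topology normedtype sequences numFieldNormedType.Exports.
Local Open Scope classical_set_scope.

Local Notation "u ~~> l" := ((u : nat -> rat^o) @ \oo --> (l : rat^o)) (at level 70).

Lemma cvg_sum_rat (I : Type) (s : seq I) (P : pred I) (u : I -> nat -> rat) (l : I -> rat) :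
  (forall i, P i -> u i ~~> l i) -> (fun n => \sum_(i <- s | P i) u i n) ~~> \sum_(i <- s | P i) l i.
Proof.
move=> ul; elim: s => [|i s IHs].
  by under boolp.eq_fun do rewrite big_nil; rewrite big_nil; apply: cvg_cst.
under boolp.eq_fun do rewrite big_cons.
rewrite big_cons; case: ifP => Pi //.
by apply: cvgD => //; apply: ul.
Qed.

Lemma cvg_exp_rat (u : nat -> rat) l k : u ~~> l -> (fun n => u n ^+ k) ~~> l ^+ k.
Proof.
move=> ul; elim: k => [|k IHk].
  by under boolp.eq_fun do rewrite expr0; rewrite expr0; apply: cvg_cst.
by under boolp.eq_fun do rewrite exprS; rewrite exprS; apply: cvgM.
Qed.

(** The coefficients of [h_of_f] depend linearly on the face numbers. The
    sequences are rational while the distance is real; reciprocals of positive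
    integers pass from one to the other. *)
Lemma h_of_f_near (R : realType) d (u : nat -> nat -> rat) (c : nat -> rat) (eps : R) :
  (forall k, (k <= d)%N -> (fun n => u n k) ~~> c k) -> 0 < eps ->
  exists N, forall n, (N <= n)%N -> coef_dist R d.+1 (h_of_f d (u n)) (h_of_f d c) < eps.
Proof.
move=> uc eps0.
have coefs i : (fun n => (h_of_f d (u n))`_i) ~~> (h_of_f d c)`_i.
  under boolp.eq_fun do rewrite coef_h_of_f.
  rewrite coef_h_of_f; apply: cvg_sum_rat => k _; apply: cvgMl; apply: uc.
  by rewrite -ltnS.
have dist : (fun n => \sum_(i < d.+1) ((h_of_f d (u n))`_i - (h_of_f d c)`_i) ^+ 2) ~~> 0.
  suff: (fun n => \sum_(i < d.+1) ((h_of_f d (u n))`_i - (h_of_f d c)`_i) ^+ 2) ~~>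
      \sum_(i < d.+1) ((h_of_f d c)`_i - (h_of_f d c)`_i) ^+ 2.
    by rewrite [X in _ --> X]big1 // => i _; rewrite subrr expr0n.
  apply: cvg_sum_rat => i _; apply: cvg_exp_rat; apply: cvgB => //; exact: cvg_cst.
have [k k_gt] : exists k : nat, (k.+1%:R : R)^-1 < eps ^+ 2.
  have e2 : 0 < eps ^+ 2 by rewrite exprn_gt0.
  exists (Num.bound (eps ^+ 2)^-1); rewrite invf_plt ?posrE ?ltr0n //.
  by apply: lt_trans (archi_boundP _) _; rewrite ?invr_ge0 ?ltW // ltr_nat.
have e_k : 0 < k.+1%:R^-1 :> rat by rewrite invr_gt0 ltr0n.
have [N _ NP] := @cvgr_dist_lt _ _ _ _ _ _ _ dist _ e_k.
exists N => n /NP; rewrite /= sub0r normrN => distn.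
rewrite /coef_dist -(ltr_sqr (x := Num.sqrt _)) ?nnegrE ?sqrtr_ge0 ?ltW //.
set s := (X in Num.sqrt X).
have sE : s = ratr (\sum_(i < d.+1) ((h_of_f d (u n))`_i - (h_of_f d c)`_i) ^+ 2).
  by rewrite rmorph_sum; apply: eq_bigr => i _; rewrite rmorphXn rmorphB.
have s0 : 0 <= s by apply: sumr_ge0 => i _; apply: sqr_ge0.
rewrite sqr_sqrtr // sE; apply: lt_trans k_gt.
rewrite -[k.+1%:R](ratr_nat R) -fmorphV ltr_rat.
exact: le_lt_trans (ler_norm _) distn.
Qed.

Lemma cvg_addn (k : nat) (u : nat -> rat) l : u ~~> l -> (fun n => u (n + k)%N) ~~> l.
Proof. by move=> ul; have := ul; rewrite -(cvg_shiftn k). Qed.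

Lemma cvg_subn (k : nat) (u : nat -> rat) l : (fun n => u (n + k)%N) ~~> l -> u ~~> l.
Proof. by move=> ul; rewrite -(cvg_shiftn k). Qed.

Lemma bin_ratio_cvg s m : (s < m)%N -> (fun n => 'C(n, s)%:R / 'C(n, m)%:R) ~~> 0.
Proof.
have step k : (fun n => 'C(n, k)%:R / 'C(n, k.+1)%:R) ~~> 0.
  apply: (@cvg_subn k.+1).
  have -> : (fun n => 'C(n + k.+1, k)%:R / 'C(n + k.+1, k.+1)%:R) =
            (fun n => k.+1%:R * n.+1%:R^-1) :> (nat -> rat).
    apply/boolp.funext => n; have := mul_bin_left (n + k.+1) k.
    rewrite -addSnnS addnK => /(congr1 (fun m => m%:R : rat)); rewrite !natrM => binE.
    have n0 : n.+1%:R != 0 :> rat by rewrite pnatr_eq0.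
    have C0 : 'C(n.+1 + k, k.+1)%:R != 0 :> rat by rewrite pnatr_eq0 -lt0n bin_gt0 addSn ltnS leq_addl.
    by apply: (canRL (mulfK n0)); rewrite mulrAC -[_ * n.+1%:R]mulrC -binE mulfK.
  suff: (fun n => k.+1%:R * n.+1%:R^-1) ~~> k.+1%:R * 0 by rewrite mulr0.
  by apply: cvgMr; exact: (@cvg_harmonic rat).
elim: m => // m IHm; rewrite ltnS leq_eqVlt => /predU1P[->//|sm].
have -> : (fun n => 'C(n, s)%:R / 'C(n, m.+1)%:R) =
          (fun n => ('C(n, s)%:R / 'C(n, m)%:R) * ('C(n, m)%:R / 'C(n, m.+1)%:R)) :> (nat -> rat).
  apply/boolp.funext => n; have [nm|mn] := ltnP n m.
    by rewrite (bin_small nm) (bin_small (leqW nm)) mulr0n invr0 !mulr0.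
  by rewrite mulrA mulfVK // pnatr_eq0 -lt0n bin_gt0.
suff: (fun n => ('C(n, s)%:R / 'C(n, m)%:R) * ('C(n, m)%:R / 'C(n, m.+1)%:R)) ~~> 0 * 0.
  by rewrite mulr0.
by apply: cvgM; [exact: IHm|].
Qed.

(** Divide numerator and denominator by the weight of [s = r'], next to which
    the other weights vanish. The shift of [n] keeps that weight nonzero. *)
Lemma flag_ratio_uniform_cvg r' k :
  (fun n => flag_ratio (uniform_matroid r' (n + r'.+1)) k) ~~> (cross_chains r' k)%:R.
Proof.
pose w n s : rat := 'C(n + r'.+1, s)%:R / 'C(n + r'.+1, r')%:R.
have w_cvg s : (s < r'.+1)%N -> (fun n => w n s) ~~> (s == r')%:R.
  rewrite ltnS leq_eqVlt => /predU1P[->|sr]; last first.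
    rewrite (ltn_eqF sr); apply: (@cvg_addn r'.+1 (fun n => 'C(n, s)%:R / 'C(n, r')%:R)).
    exact: bin_ratio_cvg.
  rewrite eqxx; have -> : w^~ r' = fun=> 1; last exact: cvg_cst.
  apply/boolp.funext => n; rewrite /w divff // pnatr_eq0 -lt0n bin_gt0.
  by rewrite addnS ltnW // ltnS leq_addl.
pose W (c : nat -> rat) n := \sum_(s < r'.+1 | odd s == odd r') w n s * c s.
have W_cvg c : W c ~~> c r'.
  suff: W c ~~> \sum_(s < r'.+1 | odd s == odd r') (nat_of_ord s == r')%:R * c s.
    rewrite [X in _ --> X](bigD1 ord_max) ?eqxx //= mul1r big1 ?addr0 // => s /andP[_ sr].
    by rewrite -[_ == _ :> nat]/(s == ord_max) (negPf sr) mul0r.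
  by apply: cvg_sum_rat => s _; apply: cvgMl; apply: w_cvg.
have -> : (fun n => flag_ratio (uniform_matroid r' (n + r'.+1)) k) =
    (fun n => W (fun s => (cross_chains s k)%:R) n / W (fun=> 1) n).
  apply/boolp.funext => n; have rn : (r' < n + r'.+1)%N by rewrite addnS ltnS leq_addl.
  rewrite /flag_ratio -[topes _ _ _]/(flag_sum setT (uniform_flats r' (n + r'.+1)) 0 setT).
  rewrite !flag_sum_uniform_top //.
  have C0 : 'C(n + r'.+1, r')%:R != 0 :> rat by rewrite pnatr_eq0 -lt0n bin_gt0 ltnW.
  have WE (c : nat -> rat) : \sum_(s < r'.+1 | odd s == odd r') 'C(n + r'.+1, s)%:R * c s =
      W c n * 'C(n + r'.+1, r')%:R.
    by rewrite mulr_suml; apply: eq_bigr => s _; rewrite /w mulrAC mulfVK.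
  rewrite (WE (fun s => (cross_chains s k)%:R)) (WE (fun=> 1)).
  by rewrite -mulf_div divff // mul1r -mulf_div divff // mulr1.
suff: (fun n => W (fun s => (cross_chains s k)%:R) n / W (fun=> 1) n) ~~> (cross_chains r' k)%:R / 1.
  by rewrite divr1.
by apply: cvgM (W_cvg _) _; apply: cvgV (W_cvg _).
Qed.

(** From here on [q] is [n.+1], so that it never vanishes. *)
Lemma qint_cvg k : (fun n => (qint n.+1 k.+1)%:R / n.+1%:R ^+ k) ~~> 1.
Proof.
have -> : (fun n => (qint n.+1 k.+1)%:R / n.+1%:R ^+ k) =
    (fun n => \sum_(i < k.+1) n.+1%:R^-1 ^+ (k - i)) :> (nat -> rat).
  apply/boolp.funext => n; have n0 : n.+1%:R != 0 :> rat by rewrite pnatr_eq0.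
  rewrite natr_sum mulr_suml; apply: eq_bigr => i _.
  rewrite natrX exprVn; apply: (canLR (mulfK _)); first by rewrite expf_neq0.
  have -> : n.+1%:R ^+ k = n.+1%:R ^+ (k - i) * n.+1%:R ^+ i :> rat.
    by rewrite -exprD subnK // -ltnS.
  by rewrite mulKf ?expf_neq0.
suff: (fun n => \sum_(i < k.+1) n.+1%:R^-1 ^+ (k - i)) ~~> \sum_(i < k.+1) 0 ^+ (k - i).
  rewrite [X in _ --> X]big_ord_recr /= subnn expr0 big1 ?add0r // => i _.
  by rewrite expr0n subn_eq0 leqNgt ltn_ord.
by apply: cvg_sum_rat => i _; apply: cvg_exp_rat; exact: (@cvg_harmonic rat).
Qed.

(** The Gaussian binomial has degree [j * (m - j)] in [q] and is monic. *)
Lemma gauss_cvg m j : (j <= m)%N ->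
  (fun n => gauss n.+1 m j / n.+1%:R ^+ (j * (m - j))) ~~> 1.
Proof.
elim: j => [_|j IHj jm].
  under boolp.eq_fun do rewrite gauss0 mul0n expr0 divr1; exact: cvg_cst.
have [d mE] : exists d, m = (j + d.+1)%N by exists (m - j.+1)%N; rewrite addnS -addSn subnKC.
have -> : (fun n => gauss n.+1 m j.+1 / n.+1%:R ^+ (j.+1 * (m - j.+1))) =
    (fun n => gauss n.+1 m j / n.+1%:R ^+ (j * (m - j)) *
       (((qint n.+1 d.+1)%:R / n.+1%:R ^+ d) / ((qint n.+1 j.+1)%:R / n.+1%:R ^+ j))) :> (nat -> rat).
  apply/boolp.funext => n; have n0 : n.+1%:R != 0 :> rat by rewrite pnatr_eq0.
  rewrite gaussS mE addKn -addSnnS addKn.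
  have q0 := qint_neq0 n.+1 j.
  have -> : n.+1%:R ^+ (j * d.+1) = n.+1%:R ^+ (j.+1 * d) * n.+1%:R ^+ j / n.+1%:R ^+ d :> rat.
    apply: (canRL (mulfK _)); first by rewrite expf_neq0.
    by rewrite -!exprD; congr (_ ^+ _); rewrite mulnS mulSn; lia.
  by field; rewrite q0 !expf_neq0.
suff: (fun n => gauss n.+1 m j / n.+1%:R ^+ (j * (m - j)) *
     (((qint n.+1 d.+1)%:R / n.+1%:R ^+ d) / ((qint n.+1 j.+1)%:R / n.+1%:R ^+ j))) ~~> 1 * (1 / 1).
  by rewrite mul1r divr1.
apply: cvgM; first exact: IHj (ltnW jm).
apply: cvgM; first exact: qint_cvg.
by apply: cvgV (qint_cvg _).
Qed.

Lemma bin2D a b : 'C(a + b, 2) = ('C(a, 2) + 'C(b, 2) + a * b)%N.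
Proof.
elim: b => [|b IHb]; first by rewrite addn0 muln0 !addn0.
by rewrite addnS !binS IHb !bin1 mulnS; lia.
Qed.

Lemma bin2_sub j m : (j <= m)%N -> 'C(m, 2) = ('C(j, 2) + 'C(m - j, 2) + j * (m - j))%N.
Proof. by move=> jm; rewrite -bin2D subnKC. Qed.

(** Only the two largest ranks matter: the term of rank [j] is of the order of
    [q] to the power [- 'C(k.+1 - j, 2)] relative to the leading one, and this
    exponent vanishes just for [j = k] and [j = k.+1]. *)
Lemma projective_topes_cvg k :
  (fun n => projective_topes n.+1 k.+1 / n.+1%:R ^+ 'C(k.+1, 2)) ~~> 2.
Proof.
have -> : (fun n => projective_topes n.+1 k.+1 / n.+1%:R ^+ 'C(k.+1, 2)) =
    (fun n => \sum_(j < k.+2) gauss n.+1 k.+1 j / n.+1%:R ^+ (j * (k.+1 - j)) *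
        n.+1%:R^-1 ^+ 'C(k.+1 - j, 2)) :> (nat -> rat).
  apply/boolp.funext => n; have n0 : n.+1%:R != 0 :> rat by rewrite pnatr_eq0.
  rewrite /projective_topes mulr_suml; apply: eq_bigr => j _.
  rewrite (bin2_sub (ltn_ord j : j <= k.+1)%N) !exprD exprVn.
  by field; rewrite !expf_neq0.
suff: (fun n => \sum_(j < k.+2) gauss n.+1 k.+1 j / n.+1%:R ^+ (j * (k.+1 - j)) *
        n.+1%:R^-1 ^+ 'C(k.+1 - j, 2)) ~~> \sum_(j < k.+2) 1 * 0 ^+ 'C(k.+1 - j, 2).
  rewrite [X in _ --> X]big_ord_recr big_ord_recr /= subnn subSnn !mul1r !expr0.
  rewrite big1 ?add0r // => i _; rewrite mul1r expr0n.
  by rewrite eqn0Ngt bin_gt0 ltn_subRL addn1 ltnS ltn_ord.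
apply: cvg_sum_rat => j _; apply: cvgM; first by apply: gauss_cvg; rewrite -ltnS.
by apply: cvg_exp_rat; exact: (@cvg_harmonic rat).
Qed.

Lemma sum_bin_col m k : (\sum_(j < m) 'C(j, k) = 'C(m, k.+1))%N.
Proof. by elim: m => [|m IHm]; rewrite ?big_ord0 // big_ord_recr /= IHm binS. Qed.

(** After division by the leading powers the recursion for flags becomes the
    summation of a column of Pascal's triangle. *)
Lemma projective_flags_cvg i m :
  (fun n => projective_flags n.+1 i m.+1 / n.+1%:R ^+ 'C(m.+1, 2)) ~~> 2 ^+ i.+1 * 'C(m, i)%:R.
Proof.
elim: i m => [|i IHi] m; first by rewrite bin0 mulr1 expr1; apply: projective_topes_cvg.
have -> : (fun n => projective_flags n.+1 i.+1 m.+1 / n.+1%:R ^+ 'C(m.+1, 2)) =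
    (fun n => \sum_(j < m) gauss n.+1 m.+1 j.+1 / n.+1%:R ^+ (j.+1 * (m.+1 - j.+1)) *
       (projective_flags n.+1 i j.+1 / n.+1%:R ^+ 'C(j.+1, 2)) *
       (projective_topes n.+1 (m - j.+1).+1 / n.+1%:R ^+ 'C((m - j.+1).+1, 2))) :> (nat -> rat).
  apply/boolp.funext => n; have n0 : n.+1%:R != 0 :> rat by rewrite pnatr_eq0.
  rewrite /= mulr_suml; apply: eq_bigr => j _.
  have jm := ltn_ord j; have -> : (m - j.+1).+1 = (m.+1 - j.+1)%N by rewrite subSn.
  rewrite (bin2_sub (leqW jm)) !exprD.
  by field; rewrite !expf_neq0.
suff: (fun n => \sum_(j < m) gauss n.+1 m.+1 j.+1 / n.+1%:R ^+ (j.+1 * (m.+1 - j.+1)) *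
       (projective_flags n.+1 i j.+1 / n.+1%:R ^+ 'C(j.+1, 2)) *
       (projective_topes n.+1 (m - j.+1).+1 / n.+1%:R ^+ 'C((m - j.+1).+1, 2))) ~~>
     \sum_(j < m) 1 * (2 ^+ i.+1 * 'C(j, i)%:R) * 2.
  rewrite -mulr_suml; under eq_bigr do rewrite mul1r.
  by rewrite -mulr_sumr -natr_sum sum_bin_col mulrAC -exprSr.
apply: cvg_sum_rat => j _; apply: cvgM; last exact: projective_topes_cvg.
by apply: cvgM; [apply: gauss_cvg; rewrite ltnS ltnW | apply: IHi].
Qed.

Lemma flag_ratio_vector n r' k : prime n.+1 ->
  flag_ratio (vector_matroid n.+1 r'.+1) k =
  projective_flags n.+1 k r'.+1 / projective_topes n.+1 r'.+1.
Proof.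
move=> n_pr; have LP := subspaces_is_flats n.+1 r'.+1.
have cL := @card_subspace n.+1 r'.+1 n_pr.
have rE := rank_vector_matroid r'.+1 n_pr.
rewrite /flag_ratio (flag_sum_projective LP (prime_gt1 n_pr) cL) ?(ground_flat LP) //.
rewrite (topes_projective LP (prime_gt1 n_pr) cL) ?(ground_flat LP) ?(bot_flat LP) //; last first.
  by rewrite bot_sub ?(ground_flat LP).
by rewrite (rk_bot LP) subn0 -[rk _ _]/(rank (vector_matroid n.+1 r'.+1)) rE.
Qed.

Lemma flag_ratio_vector_cvg r' k :
  (fun n => projective_flags n.+1 k r'.+1 / projective_topes n.+1 r'.+1) ~~> 2 ^+ k * 'C(r', k)%:R.
Proof.
have -> : (fun n => projective_flags n.+1 k r'.+1 / projective_topes n.+1 r'.+1) =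
    (fun n => (projective_flags n.+1 k r'.+1 / n.+1%:R ^+ 'C(r'.+1, 2)) /
      (projective_topes n.+1 r'.+1 / n.+1%:R ^+ 'C(r'.+1, 2))) :> (nat -> rat).
  apply/boolp.funext => n; have n0 : n.+1%:R != 0 :> rat by rewrite pnatr_eq0.
  by rewrite -mulf_div divff ?mulr1 // invr_eq0 expf_neq0.
suff: (fun n => (projective_flags n.+1 k r'.+1 / n.+1%:R ^+ 'C(r'.+1, 2)) /
      (projective_topes n.+1 r'.+1 / n.+1%:R ^+ 'C(r'.+1, 2))) ~~> 2 ^+ k.+1 * 'C(r', k)%:R / 2.
  by rewrite exprS -[2 * _ * _]mulrA [X in _ --> X]mulrC mulKf.
apply: cvgM; first exact: projective_flags_cvg.
by apply: cvgV (projective_topes_cvg _).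
Qed.

(** The binomial expansion of (1 - X) + 2 X. *)
Lemma h_of_f_cube d : h_of_f d (fun k => 2 ^+ k * 'C(d, k)%:R) = (1 + 'X) ^+ d.
Proof.
have -> : 1 + 'X = (1 - 'X) + 2%:R * 'X :> {poly rat} by ring.
rewrite exprDn; apply: eq_bigr => k _; rewrite -mul_polyC exprMn rmorphM /= rmorphXn /= !polyC_natr.
by rewrite -mulr_natr; ring.
Qed.

Theorem theorem1p5 (R : realType) :
  ((forall (T : finType) (M : matroid T), (3 <= rank M)%N -> flag_bounds M) ->
   forall r : nat, (3 <= r)%N ->
     (forall eps : R, 0 < eps ->
        exists (T : finType) (M : matroid T), rank M = r /\
          coef_dist R r (normalized_coarse_flag_poly M)
                        ((1 + 'X) ^+ r.-1) < eps)
     /\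
     (forall eps : R, 0 < eps ->
        exists (T : finType) (M : matroid T), rank M = r /\
          coef_dist R r (normalized_coarse_flag_poly M) (eulerianB r) < eps))
  /\
  ((forall (T : finType) (M : matroid T), rank M = 3%N -> flag_bounds M)
   /\
   (forall (T : finType) (M : matroid T), orientable M -> (3 <= rank M)%N ->
      (normalized_coarse_flag_poly M)`_1 < (eulerianB (rank M))`_1)
   /\
   (forall (T : finType) (M : matroid T), orientable M -> rank M = 4%N ->
      flag_bounds M)).
Proof.
split; last first.
  split; first exact: flag_bounds_rank3.
  by split=> T M _; [exact: coef1_lt_eulerianB | exact: flag_bounds_rank4].
move=> _ [//|r'] r3; split=> eps eps0.
- have [N NP] := h_of_f_near (d := r') (fun k _ => @flag_ratio_vector_cvg r' k) eps0.
  have [p Np p_pr] := prime_above N; have pE : p.-1.+1 = p by rewrite prednK ?prime_gt0.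
  have p_pr' : prime p.-1.+1 by rewrite pE.
  have rE := rank_vector_matroid r'.+1 p_pr'.
  exists _, (vector_matroid p.-1.+1 r'.+1); split=> //.
  rewrite normalized_coarse_flag_polyE ?rE // -h_of_f_cube.
  have -> : flag_ratio (vector_matroid p.-1.+1 r'.+1) =
      fun k => projective_flags p.-1.+1 k r'.+1 / projective_topes p.-1.+1 r'.+1.
    by apply/boolp.funext => k; apply: flag_ratio_vector.
  by apply: NP; rewrite -ltnS pE.
- have [N NP] := h_of_f_near (d := r') (fun k _ => @flag_ratio_uniform_cvg r' k) eps0.
  have rE : rank (uniform_matroid r' (N + r'.+1)) = r'.+1 by rewrite rank_uniform // addnS ltnS leq_addl.
  exists _, (uniform_matroid r' (N + r'.+1)); split=> //.
  by rewrite normalized_coarse_flag_polyE ?rE // eulerianBE ?(ltnW r3) //; apply: NP.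
Qed.
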